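(* Let $k\ge0$ be an integer such that the $k$th Hopf bifurcation of (1) is supercritical, i.e. $C<H(k)B^2$. Then for all sufficiently small $\eta>0$, the minimal period of the periodic solution on the $k$th Hopf branch at parameter $\mu_k+\eta$ satisfies $$T^k_\eta\ \ge\ \frac{4}{4k+1+\frac{2\eta}{\pi}}.$$
   Context: Consider the scalar delay differential equation (1) $x'(t)=-\mu f(x(t-1))$, with real parameter $\mu$ and phase space $C([-1,0],\mathbb R)$. Here $f:\mathbb R\to\mathbb R$ is $C^3$ with $f(0)=0$ and $f'(0)=1$, so that $f(\xi)=\xi+B\xi^2+C\xi^3+o(\xi^3)$ with $B=f''(0)/2$ and $C=f'''(0)/6$. For $k\in\mathbb Z$ let $\mu_k=\frac{(4k+1)\pi}{2}$ and $H(k)=\frac{22(4k+1)\pi-8}{15(4k+1)\pi}$. The $k$th Hopf bifurcation (at $\mu_k$) is supercritical if $C<H(k)B^2$ and subcritical if $C>H(k)B^2$; it is called nondegenerate if $C\ne H(k)B^2$. Supercritical means the bifurcating small periodic orbits are stable within the center manifold; subcritical means they are unstable there. Hopf branch notation, for $k\ge0$ with a nondegenerate $k$th bifurcation: put $\delta_k=1$ if it is supercritical and $\delta_k=-1$ if it is subcritical. There are $\eta_k>0$ and a family of nonconstant periodic solutions $p^k_\eta$, $\eta\in(0,\eta_k)$, of (1) with parameter $\mu=\mu_k+\delta_k\eta$. These bifurcate from $0$ at $\mu_k$ (amplitude $\to0$ as $\eta\to0$), and they are locally unique up to time translation. $T^k_\eta$ denotes the minimal period of $p^k_\eta$, and $T^k_\eta\to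 T^k_0:=\frac{4}{4k+1}$ as $\eta\to0$. *)

(* Defs.v *)
From Stdlib Require Import Reals Lra.
Open Scope R_scope.

Definition C3_with (f f1 f2 f3 : R -> R) : Prop :=
  (forall x, derivable_pt_lim f x (f1 x)) /\
  (forall x, derivable_pt_lim f1 x (f2 x)) /\
  (forall x, derivable_pt_lim f2 x (f3 x)) /\
  continuity f3.

Definition is_solution (f : R -> R) (mu : R) (x : R -> R) : Prop :=
  forall t, derivable_pt_lim x t (- mu * f (x (t - 1))).

Definition is_period (x : R -> R) (T : R) : Prop :=
  forall t, x (t + T) = x t.

Definition is_min_period (x : R -> R) (T : R) : Prop :=
  0 < T /\ is_period x T /\ (forall S, 0 < S < T -> ~ is_period x S).

Definition nonconstant (x : R -> R) : Prop := exists s t, x s <> x t.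

Definition mu_k (k : nat) : R := (4 * INR k + 1) * PI / 2.

Definition H (k : nat) : R :=
  (22 * (4 * INR k + 1) * PI - 8) / (15 * (4 * INR k + 1) * PI).

Definition T0 (k : nat) : R := 4 / (4 * INR k + 1).

Definition supercritical_hopf_branch (f : R -> R) (k : nat) (eta0 : R)
    (p : R -> R -> R) : Prop :=
  0 < eta0 /\
  (forall eta, 0 < eta < eta0 ->
     is_solution f (mu_k k + eta) (p eta) /\ nonconstant (p eta) /\
     exists T, is_min_period (p eta) T) /\
  (forall eps, 0 < eps -> exists d, 0 < d /\
     forall eta, 0 < eta < d -> eta < eta0 -> forall t, Rabs (p eta t) < eps) /\
  (forall eps, 0 < eps -> exists d, 0 < d /\
     forall eta T, 0 < eta < d -> eta < eta0 ->
       is_min_period (p eta) T -> Rabs (T - T0 k) < eps).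

(* Main.v *)
(** With omega = 2 pi / T, the bound is equivalent to omega <= mu. In the rescaled time
    y(s) = x(s / omega) the equation reads y'(s) = - nu F(y(s - th)), where y is
    2 pi-periodic, nu = mu / omega is close to 1 and th = omega - 2 pi k is close to pi / 2;
    one has to show 1 <= nu. Translate time so that y = A cos + w, where w has no first
    Fourier mode. Then w = O(A^2), and the modes 0 and 2 of the equation give the modes 0
    and 2 of w up to o(A^2). Taking the modulus of the first mode of the equation yields
    1 = nu |1 + c A^2 + o(A^2)| with Re c = 3/4 (C - 22/15 B^2). Since H(k) < 22/15,
    supercriticality makes Re c negative, hence 1 < nu for small A > 0. *)

Require Import Defs.
From Stdlib Require Import Reals Lra.
From Coquelicot Require Import Coquelicot.
Open Scope R_scope.

(** No Fourier series is formed. Since [th] is near a quarter of the period [2 * PI], the limiting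
    equation [w'(t) = - w(t - PI / 2) + G(t)] closes on the four quarter shifts of [w] and becomes a
    finite linear system, so off the first mode its solutions are bounded in sup norm by elementary
    means. The deviations of [nu] from 1 and of [th] from [PI / 2] are then perturbations of this
    system. The obstacle is that these deviations are only known to be small, with no rate in terms
    of the amplitude [A]. Hence all estimates are uniform in them: a single threshold [s] governs
    every smallness assumption, and error terms carry a factor [s] besides their power of [A]. The
    delay acts on the first mode as a rotation by [th], so comparing moduli eliminates [th] exactly
    and leaves [nu] alone. The resulting condition on [B] and [C] is free of [k], whereas [H k]
    equals 22/15 minus [8 / (15 * (4 * INR k + 1) * PI)]. *)

(** * Means over one period *)

Definition periodic (g : R -> R) : Prop := forall t, g (t + 2 * PI) = g t.

(** A relation rather than a function: it carries integrability together with the value, so means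
    combine without side conditions. *)
Definition is_mean (g : R -> R) (v : R) : Prop := is_RInt g 0 (2 * PI) (2 * PI * v).

Lemma is_mean_ext (g h : R -> R) (v : R) :
  (forall t, g t = h t) -> is_mean g v -> is_mean h v.
Proof. intros E; apply is_RInt_ext; intros t _; apply E. Qed.

Lemma is_mean_plus (g h : R -> R) (u v : R) :
  is_mean g u -> is_mean h v -> is_mean (fun t => g t + h t) (u + v).
Proof.
intros Hg Hh; unfold is_mean.
replace (2 * PI * (u + v)) with (plus (2 * PI * u) (2 * PI * v))
  by (unfold plus; simpl; ring).
now apply (is_RInt_plus (V := R_NormedModule)).
Qed.

Lemma is_mean_scal (c : R) (g : R -> R) (v : R) :
  is_mean g v -> is_mean (fun t => c * g t) (c * v).
Proof.
intros Hg; unfold is_mean.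
replace (2 * PI * (c * v)) with (scal c (2 * PI * v))
  by (unfold scal; simpl; unfold mult; simpl; ring).
now apply (is_RInt_scal (V := R_NormedModule)).
Qed.

Lemma is_mean_const (c : R) : is_mean (fun _ => c) c.
Proof.
unfold is_mean.
replace (2 * PI * c) with (scal (2 * PI - 0) c)
  by (unfold scal; simpl; unfold mult; simpl; ring).
apply (is_RInt_const (V := R_NormedModule)).
Qed.

Lemma is_mean_unique (g : R -> R) (u v : R) : is_mean g u -> is_mean g v -> u = v.
Proof.
intros Hu Hv; apply (is_RInt_unique (V := R_CompleteNormedModule)) in Hu, Hv.
pose proof PI_RGT_0; apply Rmult_eq_reg_l with (2 * PI); lra.
Qed.

Lemma is_mean_bound (g : R -> R) (v K : R) :
  is_mean g v -> (forall t, 0 <= t <= 2 * PI -> Rabs (g t) <= K) -> Rabs v <= K.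
Proof.
intros Hg HK; pose proof PI_RGT_0.
assert (B : Rabs (2 * PI * v) <= (2 * PI - 0) * K).
{ apply (norm_RInt_le_const (V := R_NormedModule) g 0 (2 * PI)); [lra | exact HK | exact Hg]. }
rewrite Rabs_mult, (Rabs_right (2 * PI)) in B by lra.
apply Rmult_le_reg_l with (2 * PI); lra.
Qed.

Lemma ex_mean (g : R -> R) : (forall t, ex_derive g t) -> exists v, is_mean g v.
Proof.
intros Hg; pose proof PI_RGT_0.
assert (E : forall I : R, 2 * PI * (I / (2 * PI)) = I) by (intros; field; lra).
exists (RInt g 0 (2 * PI) / (2 * PI)); unfold is_mean; rewrite E.
apply (RInt_correct (V := R_CompleteNormedModule)), ex_RInt_continuous.
intros t _; apply (ex_derive_continuous (K := R_AbsRing) (V := R_NormedModule)), Hg.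
Qed.

(** A derivative has mean zero when the primitive agrees at both ends. Splitting off [c] lets an
    explicit mean be certified by a primitive of [g - c]; integration by parts in the mode equations
    is the case [c = 0]. *)
Lemma is_mean_derive (h g : R -> R) (c : R) :
  (forall t, is_derive h t (g t - c)) -> (forall t, ex_derive g t) ->
  h (2 * PI) = h 0 -> is_mean g c.
Proof.
intros Hh Hg E.
apply is_mean_ext with (fun t => (g t - c) + c); [intros; ring|].
cut (is_mean (fun t => g t - c + c) (0 + c)); [now rewrite Rplus_0_l|].
apply is_mean_plus; [|apply is_mean_const].
unfold is_mean; replace (2 * PI * 0) with (minus (h (2 * PI)) (h 0))
  by (unfold minus, plus, opp; simpl; lra).
apply (is_RInt_derive (V := R_CompleteNormedModule)); intros t _.
- apply Hh.
- apply (ex_derive_continuous (K := R_AbsRing) (V := R_NormedModule)).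
  apply (ex_derive_minus (V := R_NormedModule)); [apply Hg | apply ex_derive_const].
Qed.

(** The window from [- a] to [2 * PI - a] is cut at 0 and [2 * PI]; by periodicity the two end
    pieces cancel. Oriented integrals make this work for either sign of [a]. *)
Lemma is_mean_shift (a : R) (g : R -> R) (v : R) :
  periodic g -> (forall t, ex_derive g t) ->
  is_mean g v -> is_mean (fun t => g (t - a)) v.
Proof.
intros Pg Dg Hg; unfold is_mean.
assert (Ig : forall b c, is_RInt g b c (RInt g b c)).
{ intros b c; apply (RInt_correct (V := R_CompleteNormedModule)), ex_RInt_continuous.
  intros t _; apply (ex_derive_continuous (K := R_AbsRing) (V := R_NormedModule)), Dg. }
assert (Itail : is_RInt g (2 * PI) (2 * PI - a) (RInt g 0 (- a))).
{ assert (I := Ig 0 (- a)).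
  replace 0 with (1 * (2 * PI) + - (2 * PI)) in I at 1 by ring.
  replace (- a) with (1 * (2 * PI - a) + - (2 * PI)) in I at 1 by ring.
  apply (is_RInt_comp_lin (V := R_NormedModule)) in I.
  eapply is_RInt_ext; [|exact I]; intros t _; unfold scal; simpl; unfold mult; simpl.
  rewrite <- (Pg (1 * t + - (2 * PI))), Rmult_1_l; f_equal; ring. }
assert (I : is_RInt g (- a) (2 * PI - a) (2 * PI * v)).
{ replace (2 * PI * v) with (plus (plus (RInt g (- a) 0) (2 * PI * v)) (RInt g 0 (- a))).
  - eapply (is_RInt_Chasles (V := R_NormedModule)); [|exact Itail].
    eapply (is_RInt_Chasles (V := R_NormedModule)); [apply Ig | exact Hg].
  - rewrite <- (opp_RInt_swap (V := R_CompleteNormedModule) g (-a) 0)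
      by (eexists; apply Ig).
    unfold plus, opp; simpl; ring. }
replace (- a) with (1 * 0 + - a) in I by ring.
replace (2 * PI - a) with (1 * (2 * PI) + - a) in I by ring.
apply (is_RInt_comp_lin (V := R_NormedModule)) in I.
eapply is_RInt_ext; [|exact I]; intros t _; unfold scal; simpl; unfold mult; simpl.
rewrite Rmult_1_l; f_equal; ring.
Qed.

(** * Sup bounds from differential equations *)

Lemma lipschitz_of_derive (h dh : R -> R) (K : R) :
  (forall t, is_derive h t (dh t)) -> (forall t, Rabs (dh t) <= K) ->
  forall s t, Rabs (h t - h s) <= K * Rabs (t - s).
Proof.
intros Dh HK s t.
destruct (MVT_gen h s t dh) as [c [_ Ec]].
- intros; apply Dh.
- intros u _; apply continuity_pt_filterlim.
  apply (ex_derive_continuous (K := R_AbsRing) (V := R_NormedModule)); eexists; apply Dh.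
- rewrite Ec, Rabs_mult; apply Rmult_le_compat_r; [apply Rabs_pos | apply HK].
Qed.

Lemma nonincreasing_of_derive (h dh : R -> R) :
  (forall t, is_derive h t (dh t)) -> (forall t, dh t <= 0) ->
  forall s t, s <= t -> h t <= h s.
Proof.
intros Dh HK s t Hst.
destruct (MVT_gen h s t dh) as [c [_ Ec]].
- intros; apply Dh.
- intros u _; apply continuity_pt_filterlim.
  apply (ex_derive_continuous (K := R_AbsRing) (V := R_NormedModule)); eexists; apply Dh.
- pose proof (HK c); nra.
Qed.

(** The function [(y - K) * exp (- l * t)] has derivative [(g + l * K) * exp (- l * t)], whose sign
    is that of [l]. If [y t > K], periodicity of [y] makes this function move the opposite way over
    one period, because only the exponential factor changes. *)
Lemma periodic_hyperbolic_upper (l : R) (y g : R -> R) (K : R) :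
  l = 1 \/ l = -1 ->
  periodic y -> (forall t, is_derive y t (l * y t + g t)) ->
  (forall t, Rabs (g t) <= K) -> forall t, y t <= K.
Proof.
intros Hl Py Dy HK t; pose proof PI_RGT_0.
assert (D : forall t, is_derive (fun t => (y t - K) * exp (- l * t)) t
                        ((g t + l * K) * exp (- l * t))).
{ intros s; auto_derive; [repeat split; eexists; apply Dy|].
  assert (Dy1 : Derive (fun x => y x) s = l * y s + g s) by apply is_derive_unique, Dy.
  rewrite Dy1; ring. }
destruct (Rle_or_lt (y t) K) as [|Hlt]; [assumption|exfalso].
destruct Hl as [-> | ->].
- assert (M : - ((y t - K) * exp (- (1) * t)) >= - ((y (t + 2 * PI) - K) * exp (- (1) * (t + 2 * PI)))).
  { apply Rle_ge.
    apply (nonincreasing_of_derive (fun t => - ((y t - K) * exp (- (1) * t)))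
             (fun t => - ((g t + 1 * K) * exp (- (1) * t)))); [| |lra].
    - intros s; apply (is_derive_opp (V := R_NormedModule)), D.
    - intros s; pose proof (exp_pos (- (1) * s)); pose proof (HK s).
      apply Rabs_le_between in H1; nra. }
  rewrite Py in M.
  assert (exp (- (1) * (t + 2 * PI)) < exp (- (1) * t)) by (apply exp_increasing; lra).
  nra.
- assert (M : (y (t + 2 * PI) - K) * exp (- -1 * (t + 2 * PI)) <= (y t - K) * exp (- -1 * t)).
  { apply (nonincreasing_of_derive (fun t => (y t - K) * exp (- -1 * t))
             (fun t => (g t + -1 * K) * exp (- -1 * t))); [exact D| |lra].
    intros s; pose proof (exp_pos (- -1 * s)); pose proof (HK s).
    apply Rabs_le_between in H1; nra. }
  rewrite Py in M.
  assert (exp (- -1 * t) < exp (- -1 * (t + 2 * PI))) by (apply exp_increasing; lra).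
  nra.
Qed.

Lemma periodic_hyperbolic_bound (l : R) (y g : R -> R) (K : R) :
  l = 1 \/ l = -1 ->
  periodic y -> (forall t, is_derive y t (l * y t + g t)) ->
  (forall t, Rabs (g t) <= K) -> forall t, Rabs (y t) <= K.
Proof.
intros Hl Py Dy HK t; apply Rabs_le; split.
- enough (- y t <= K) by lra.
  apply (periodic_hyperbolic_upper l (fun t => - y t) (fun t => - g t)); trivial.
  + intros s; now rewrite Py.
  + intros s; replace (l * - y s + - g s) with (opp (l * y s + g s))
      by (unfold opp; simpl; ring).
    apply (is_derive_opp (V := R_NormedModule)), Dy.
  + intros s; now rewrite Rabs_Ropp.
- now apply (periodic_hyperbolic_upper l y g).
Qed.

(** Over the window starting at [t] the mean of [h] is zero, so [- h t] is the mean of the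
    increments [h s - h t], each at most the window length times [K]. *)
Lemma mean_zero_bound (h dh : R -> R) (K : R) :
  periodic h -> (forall t, is_derive h t (dh t)) -> (forall t, Rabs (dh t) <= K) ->
  is_mean h 0 -> forall t, Rabs (h t) <= 2 * PI * K.
Proof.
intros Ph Dh HK Mh t.
apply (is_mean_shift (- t)) in Mh; [|assumption|intros; eexists; apply Dh].
assert (Mc := is_mean_plus _ _ _ _ Mh (is_mean_const (- h t))).
rewrite <- Rabs_Ropp, <- (Rplus_0_l (- h t)).
apply (is_mean_bound _ _ _ Mc); intros s Hs.
eapply Rle_trans.
- apply (lipschitz_of_derive h dh K Dh HK t (s - - t)).
- replace (s - - t - t) with s by ring.
  rewrite Rabs_right by lra.
  assert (0 <= K) by (eapply Rle_trans; [apply Rabs_pos | apply (HK 0)]). nra.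
Qed.

(** * Quarter shifts and the limiting linear equation *)

Lemma periodic_shift (a : R) (g : R -> R) : periodic g -> periodic (fun t => g (t - a)).
Proof.
intros Pg t; replace (t + 2 * PI - a) with (t - a + 2 * PI) by ring; apply Pg.
Qed.

Lemma cos_sin_quarter (t : R) :
  cos (t - PI / 2) = sin t /\ sin (t - PI / 2) = - cos t.
Proof.
rewrite cos_minus, sin_minus, cos_PI2, sin_PI2; split; ring.
Qed.

(** Up to the factor 4, the projection onto the Fourier modes divisible by four. Applied to
    [w * cos] and [w * sin] it captures the odd modes of [w]. *)
Definition quarter_sum (h : R -> R) (t : R) : R :=
  h t + h (t - PI / 2) + h (t - PI) + h (t - 3 * PI / 2).

Lemma is_mean_quarter_sum (h : R -> R) (v : R) :
  periodic h -> (forall t, ex_derive h t) -> is_mean h v ->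
  is_mean (quarter_sum h) (4 * v).
Proof.
intros Ph Dh Hh; replace (4 * v) with (v + v + v + v) by ring.
pose proof (fun a => is_mean_shift a h v Ph Dh Hh) as Hs.
exact (is_mean_plus _ _ _ _ (is_mean_plus _ _ _ _ (is_mean_plus _ _ _ _ Hh (Hs _)) (Hs _)) (Hs _)).
Qed.

Lemma periodic_quarter_sum (h : R -> R) : periodic h -> periodic (quarter_sum h).
Proof.
intros Ph t; unfold quarter_sum.
now rewrite Ph, (periodic_shift (PI / 2) h Ph t), (periodic_shift PI h Ph t),
  (periodic_shift (3 * PI / 2) h Ph t).
Qed.

(* The four quarter shifts of w diagonalise the equation: their sum and alternating sum solve
   hyperbolic scalar equations, and the first modes decouple in rotating coordinates into
   quarter sums with small derivative and mean zero. *)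
Lemma quarter_delay_bound (w G : R -> R) (K : R) :
  periodic w -> (forall t, is_derive w t (- w (t - PI / 2) + G t)) ->
  (forall t, Rabs (G t) <= K) ->
  is_mean (fun t => w t * cos t) 0 -> is_mean (fun t => w t * sin t) 0 ->
  forall t, Rabs (w t) <= 34 * K.
Proof.
intros Pw Dw HK Mc Ms t; pose proof PI_RGT_0 as Hpi; pose proof PI_4 as Hpi4.
assert (Ew : forall s, ex_derive w s) by (intros; eexists; apply Dw).
assert (w2 : forall s, w (s - PI / 2 - PI / 2) = w (s - PI)) by (intros; f_equal; lra).
assert (w3 : forall s, w (s - PI - PI / 2) = w (s - 3 * PI / 2)) by (intros; f_equal; lra).
(* Periodicity closes the cycle: a fourth quarter shift returns to [w]. *)
assert (w4 : forall s, w (s - 3 * PI / 2 - PI / 2) = w s).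
{ intros s; rewrite <- (Pw (s - 3 * PI / 2 - PI / 2)); f_equal; lra. }
assert (c2 : forall s, cos (s - PI) = - cos s /\ sin (s - PI) = - sin s).
{ intros s; rewrite cos_minus, sin_minus, cos_PI, sin_PI; split; ring. }
assert (c3 : forall s, cos (s - 3 * PI / 2) = - sin s /\ sin (s - 3 * PI / 2) = cos s).
{ intros s; replace (s - 3 * PI / 2) with (s - PI - PI / 2) by lra.
  destruct (cos_sin_quarter (s - PI)) as [-> ->], (c2 s) as [-> ->]; split; ring. }
assert (Dw1 : forall s, Derive (fun x => w x) s = - w (s - PI / 2) + G s)
  by (intros; apply is_derive_unique, Dw).
assert (HG : forall s, - K <= G s <= K) by (intros; apply Rabs_le_between, HK).
assert (Bnd : forall a b c d s, Rabs a <= 1 -> Rabs b <= 1 -> Rabs c <= 1 -> Rabs d <= 1 ->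
   Rabs (a * G s + b * G (s - PI / 2) + c * G (s - PI) + d * G (s - 3 * PI / 2)) <= 4 * K).
{ intros a b c d s Ha Hb Hc Hd.
  assert (M : forall e r, Rabs e <= 1 -> Rabs (e * G r) <= K).
  { intros e r He; rewrite Rabs_mult; pose proof (HK r); pose proof (Rabs_pos (G r));
      pose proof (Rabs_pos e); nra. }
  eapply Rle_trans; [apply Rabs_triang|].
  eapply Rle_trans; [apply Rplus_le_compat_r, Rabs_triang|].
  eapply Rle_trans; [apply Rplus_le_compat_r, Rplus_le_compat_r, Rabs_triang|].
  pose proof (M a s Ha); pose proof (M b (s - PI / 2) Hb); pose proof (M c (s - PI) Hc);
    pose proof (M d (s - 3 * PI / 2) Hd); lra. }
assert (one : Rabs 1 <= 1) by (rewrite Rabs_R1; lra).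
assert (mone : Rabs (-1) <= 1) by (rewrite Rabs_left; lra).
assert (cb : forall s, Rabs (cos s) <= 1) by (intros; apply Rabs_le, COS_bound).
assert (sb : forall s, Rabs (sin s) <= 1) by (intros; apply Rabs_le, SIN_bound).
assert (ncb : forall s, Rabs (- cos s) <= 1) by (intros; rewrite Rabs_Ropp; apply cb).
assert (nsb : forall s, Rabs (- sin s) <= 1) by (intros; rewrite Rabs_Ropp; apply sb).
assert (HS : Rabs (quarter_sum w t) <= 4 * K).
{ apply (periodic_hyperbolic_bound (-1) (quarter_sum w)
    (fun s => 1 * G s + 1 * G (s - PI / 2) + 1 * G (s - PI) + 1 * G (s - 3 * PI / 2)));
    [now right | now apply periodic_quarter_sum | | intros; now apply Bnd].
  intros s; unfold quarter_sum; auto_derive; [repeat split; apply Ew|].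
  unfold Rminus, Rdiv in *; rewrite !Dw1, ?w2, ?w3, ?w4; ring. }
assert (HD : Rabs (w t - w (t - PI / 2) + w (t - PI) - w (t - 3 * PI / 2)) <= 4 * K).
{ apply (periodic_hyperbolic_bound 1
    (fun t => w t - w (t - PI / 2) + w (t - PI) - w (t - 3 * PI / 2))
    (fun s => 1 * G s + -1 * G (s - PI / 2) + 1 * G (s - PI) + -1 * G (s - 3 * PI / 2)));
    [now left | | | intros; now apply Bnd].
  - intros s; now rewrite Pw, (periodic_shift (PI / 2) w Pw s), (periodic_shift PI w Pw s),
      (periodic_shift (3 * PI / 2) w Pw s).
  - intros s; auto_derive; [repeat split; apply Ew|].
    unfold Rminus, Rdiv in *; rewrite !Dw1, ?w2, ?w3, ?w4; ring. }
assert (HC : forall s, quarter_sum (fun t => w t * cos t) s =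
   w s * cos s + w (s - PI / 2) * sin s - w (s - PI) * cos s - w (s - 3 * PI / 2) * sin s).
{ intros s; unfold quarter_sum; destruct (cos_sin_quarter s) as [-> _], (c2 s) as [-> _],
    (c3 s) as [-> _]; ring. }
assert (HN : forall s, quarter_sum (fun t => w t * sin t) s =
   w s * sin s - w (s - PI / 2) * cos s - w (s - PI) * sin s + w (s - 3 * PI / 2) * cos s).
{ intros s; unfold quarter_sum; destruct (cos_sin_quarter s) as [_ ->], (c2 s) as [_ ->],
    (c3 s) as [_ ->]; ring. }
assert (Pc : periodic (fun t => w t * cos t)).
{ intros s; rewrite Pw; f_equal; rewrite cos_plus, cos_2PI, sin_2PI; ring. }
assert (Ps : periodic (fun t => w t * sin t)).
{ intros s; rewrite Pw; f_equal; rewrite sin_plus, cos_2PI, sin_2PI; ring. }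
(* Here [Mc] and [Ms] enter: they give the two rotated quarter sums mean zero, so that the bound on
   their derivatives suffices. *)
assert (HR1 : Rabs (quarter_sum (fun t => w t * cos t) t) <= 2 * PI * (4 * K)).
{ apply (mean_zero_bound _ (fun s => cos s * G s + sin s * G (s - PI / 2)
           + - cos s * G (s - PI) + - sin s * G (s - 3 * PI / 2))).
  - now apply periodic_quarter_sum.
  - intros s; apply (is_derive_ext _ _ _ _ (fun u => eq_sym (HC u))).
    auto_derive; [repeat split; apply Ew|].
    unfold Rminus, Rdiv in *; rewrite !Dw1, ?w2, ?w3, ?w4; ring.
  - intros; now apply Bnd.
  - rewrite <- (Rmult_0_r 4); apply is_mean_quarter_sum; trivial.
    intros s; auto_derive; repeat split; apply Ew. }
assert (HR2 : Rabs (quarter_sum (fun t => w t * sin t) t) <= 2 * PI * (4 * K)).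
{ apply (mean_zero_bound _ (fun s => sin s * G s + - cos s * G (s - PI / 2)
           + - sin s * G (s - PI) + cos s * G (s - 3 * PI / 2))).
  - now apply periodic_quarter_sum.
  - intros s; apply (is_derive_ext _ _ _ _ (fun u => eq_sym (HN u))).
    auto_derive; [repeat split; apply Ew|].
    unfold Rminus, Rdiv in *; rewrite !Dw1, ?w2, ?w3, ?w4; ring.
  - intros; now apply Bnd.
  - rewrite <- (Rmult_0_r 4); apply is_mean_quarter_sum; trivial.
    intros s; auto_derive; repeat split; apply Ew. }
set (r1 := quarter_sum (fun t => w t * cos t) t) in *.
set (r2 := quarter_sum (fun t => w t * sin t) t) in *.
set (d := w t - w (t - PI / 2) + w (t - PI) - w (t - 3 * PI / 2)) in *.
(* Inverts the change of coordinates: the first quotient is the half sum of [w t] and [w (t - PI)],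
   the second their half difference. With [PI <= 4] the bounds give [8 * K / 4 + 64 * K / 2], whence
   the constant 34. *)
assert (E : w t = (quarter_sum w t + d) / 4 + (cos t * r1 + sin t * r2) / 2).
{ unfold r1, r2; rewrite HC, HN; unfold quarter_sum, d.
  pose proof (sin2_cos2 t) as T; unfold Rsqr in T.
  replace (cos t * (w t * cos t + w (t - PI / 2) * sin t - w (t - PI) * cos t
      - w (t - 3 * PI / 2) * sin t) + sin t * (w t * sin t - w (t - PI / 2) * cos t
      - w (t - PI) * sin t + w (t - 3 * PI / 2) * cos t))
    with ((w t - w (t - PI)) * (sin t * sin t + cos t * cos t)) by ring.
  rewrite T; field. }
assert (K0 : 0 <= K) by (eapply Rle_trans; [apply Rabs_pos | apply (HK 0)]).
assert (B1 : Rabs (cos t * r1) <= 32 * K).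
{ rewrite Rabs_mult; pose proof (cb t); pose proof (Rabs_pos r1); pose proof (Rabs_pos (cos t)); nra. }
assert (B2 : Rabs (sin t * r2) <= 32 * K).
{ rewrite Rabs_mult; pose proof (sb t); pose proof (Rabs_pos r2); pose proof (Rabs_pos (sin t)); nra. }
rewrite E; apply Rabs_le.
apply Rabs_le_between in HS, HD, B1, B2; lra.
Qed.

(** * Suprema and Lipschitz bounds *)

(** Minimality of [W] is what permits absorption: once [W] is known to bound [w], an improved bound
    such as [W / 2 + c] must be at least [W], which bounds [W] itself. *)
Lemma sup_abs (w : R -> R) (K : R) :
  (forall t, Rabs (w t) <= K) ->
  exists W, (forall t, Rabs (w t) <= W) /\
    forall W', (forall t, Rabs (w t) <= W') -> W <= W'.
Proof.
intros HK.
destruct (completeness (fun z => exists t, z = Rabs (w t))) as [W [UB LB]].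
- exists K; intros z [t ->]; apply HK.
- now exists (Rabs (w 0)), 0.
- exists W; split.
  + intros t; apply UB; now exists t.
  + intros W' HW'; apply LB; intros z [t ->]; apply HW'.
Qed.

Lemma Rabs_mult_le (a b x y : R) : Rabs a <= x -> Rabs b <= y -> Rabs (a * b) <= x * y.
Proof.
intros; rewrite Rabs_mult; apply Rmult_le_compat; trivial; apply Rabs_pos.
Qed.

Lemma cos_sin_lipschitz (s t : R) :
  Rabs (cos t - cos s) <= Rabs (t - s) /\ Rabs (sin t - sin s) <= Rabs (t - s).
Proof.
rewrite <- (Rmult_1_l (Rabs (t - s))); split.
- apply (lipschitz_of_derive cos (fun u => - sin u)).
  + intros u; auto_derive; [trivial | ring].
  + intros u; rewrite Rabs_Ropp; apply Rabs_le, SIN_bound.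
- apply (lipschitz_of_derive sin cos).
  + intros u; auto_derive; [trivial | ring].
  + intros u; apply Rabs_le, COS_bound.
Qed.

(** * Fourier modes of the equation and trigonometric means *)

(** Real and imaginary parts of [i n Y = - nu exp(- i n th) Z], where [Y = a - i b] and
    [Z = Fa - i Fb]: integration by parts turns the derivative into multiplication by [i n], and the
    delay is a rotation of the mode. *)
Lemma mode_equation (F y : R -> R) (nu th n a b Fa Fb : R) :
  cos (n * (2 * PI)) = 1 -> sin (n * (2 * PI)) = 0 ->
  (forall z, ex_derive F z) -> periodic y ->
  (forall t, is_derive y t (- nu * F (y (t - th)))) ->
  is_mean (fun t => y t * cos (n * t)) a -> is_mean (fun t => y t * sin (n * t)) b ->
  is_mean (fun t => F (y t) * cos (n * t)) Fa ->
  is_mean (fun t => F (y t) * sin (n * t)) Fb ->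
  n * b = - nu * (Fa * cos (n * th) - Fb * sin (n * th)) /\
  - n * a = - nu * (Fb * cos (n * th) + Fa * sin (n * th)).
Proof.
intros Cn Sn DF Py Dy Ha Hb HFa HFb.
assert (Ey : forall t, ex_derive y t) by (intros; eexists; apply Dy).
assert (Dy1 : forall t, Derive (fun x => y x) t = - nu * F (y (t - th)))
  by (intros; apply is_derive_unique, Dy).
assert (Cp : forall t, cos (n * (t + 2 * PI)) = cos (n * t)).
{ intros t; rewrite Rmult_plus_distr_l, cos_plus, Cn, Sn; ring. }
assert (Sp : forall t, sin (n * (t + 2 * PI)) = sin (n * t)).
{ intros t; rewrite Rmult_plus_distr_l, sin_plus, Cn, Sn; ring. }
assert (Sa : is_mean (fun t => F (y (t - th)) * cos (n * (t - th))) Fa).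
{ apply (is_mean_shift th (fun t => F (y t) * cos (n * t))); trivial.
  - intros t; now rewrite Py, Cp.
  - intros t; auto_derive; repeat split; trivial. }
assert (Sb : is_mean (fun t => F (y (t - th)) * sin (n * (t - th))) Fb).
{ apply (is_mean_shift th (fun t => F (y t) * sin (n * t))); trivial.
  - intros t; now rewrite Py, Sp.
  - intros t; auto_derive; repeat split; trivial. }
assert (y2 : y (2 * PI) = y 0) by (rewrite <- (Py 0); f_equal; ring).
assert (Ct : forall t, cos (n * t) = cos (n * (t - th)) * cos (n * th) - sin (n * (t - th)) * sin (n * th)).
{ intros t; rewrite <- cos_plus; f_equal; ring. }
assert (St : forall t, sin (n * t) = sin (n * (t - th)) * cos (n * th) + cos (n * (t - th)) * sin (n * th)).
{ intros t; rewrite <- sin_plus; f_equal; ring. }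
split.
- assert (M1 : is_mean (fun t => - nu * F (y (t - th)) * cos (n * t) - n * (y t * sin (n * t))) 0).
  { apply is_mean_derive with (fun t => y t * cos (n * t)).
    - intros t; auto_derive; [repeat split; trivial|]. rewrite Dy1; ring.
    - intros t; auto_derive; repeat split; trivial.
    - now rewrite y2, Cn, Rmult_0_r, cos_0. }
  apply (is_mean_unique (fun t => - nu * F (y (t - th)) * cos (n * t))).
  + replace (n * b) with (0 + n * b) by ring.
    eapply is_mean_ext; [|exact (is_mean_plus _ _ _ _ M1 (is_mean_scal n _ _ Hb))].
    intros t; simpl; ring.
  + replace (- nu * (Fa * cos (n * th) - Fb * sin (n * th))) with
      (- nu * cos (n * th) * Fa + nu * sin (n * th) * Fb) by ring.
    eapply is_mean_ext; [|exact (is_mean_plus _ _ _ _ (is_mean_scal _ _ _ Sa) (is_mean_scal _ _ _ Sb))].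
    intros t; simpl; rewrite (Ct t); ring.
- assert (M1 : is_mean (fun t => - nu * F (y (t - th)) * sin (n * t) + n * (y t * cos (n * t))) 0).
  { apply is_mean_derive with (fun t => y t * sin (n * t)).
    - intros t; auto_derive; [repeat split; trivial|]. rewrite Dy1; ring.
    - intros t; auto_derive; repeat split; trivial.
    - now rewrite y2, Sn, (Rmult_0_r n), sin_0. }
  apply (is_mean_unique (fun t => - nu * F (y (t - th)) * sin (n * t))).
  + replace (- n * a) with (0 + - n * a) by ring.
    eapply is_mean_ext; [|exact (is_mean_plus _ _ _ _ M1 (is_mean_scal (- n) _ _ Ha))].
    intros t; simpl; ring.
  + replace (- nu * (Fb * cos (n * th) + Fa * sin (n * th))) with
      (- nu * cos (n * th) * Fb + - nu * sin (n * th) * Fa) by ring.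
    eapply is_mean_ext; [|exact (is_mean_plus _ _ _ _ (is_mean_scal _ _ _ Sb) (is_mean_scal _ _ _ Sa))].
    intros t; simpl; rewrite (St t); ring.
Qed.

Lemma is_mean_cos_pow :
  is_mean (fun t => cos t ^ 1) 0 /\ is_mean (fun t => cos t ^ 2) (1 / 2) /\
  is_mean (fun t => cos t ^ 3) 0 /\ is_mean (fun t => cos t ^ 4) (3 / 8) /\
  is_mean (fun t => cos t ^ 5) 0.
Proof.
assert (S2 : forall t, sin t * sin t = 1 - cos t * cos t).
{ intros t; pose proof (sin2_cos2 t) as T; unfold Rsqr in T; lra. }
repeat split.
- apply is_mean_derive with sin.
  + intros t; auto_derive; [trivial | ring].
  + intros t; auto_derive; trivial.
  + now rewrite sin_2PI, sin_0.
- apply is_mean_derive with (fun t => sin t * cos t / 2).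
  + intros t; auto_derive; [trivial|].
    match goal with |- ?l = _ => replace l with ((cos t ^ 2 - sin t * sin t) / 2) by field end.
    rewrite S2; field.
  + intros t; auto_derive; trivial.
  + rewrite sin_2PI, sin_0, cos_2PI, cos_0; field.
- apply is_mean_derive with (fun t => sin t - sin t ^ 3 / 3).
  + intros t; auto_derive; [trivial|].
    match goal with |- ?l = _ => replace l with (cos t * (1 - sin t * sin t)) by (simpl; field) end.
    rewrite S2; ring.
  + intros t; auto_derive; trivial.
  + now rewrite sin_2PI, sin_0.
- apply is_mean_derive with (fun t => cos t ^ 3 * sin t / 4 + 3 / 8 * (sin t * cos t)).
  + intros t; auto_derive; [trivial|].
    match goal with |- ?l = _ => replace l with
      ((cos t ^ 4 - 3 * cos t ^ 2 * (sin t * sin t)) / 4 + 3 / 8 * (cos t ^ 2 - sin t * sin t))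
      by (simpl; field) end.
    rewrite S2; field.
  + intros t; auto_derive; trivial.
  + rewrite sin_2PI, sin_0, cos_2PI, cos_0; field.
- apply is_mean_derive with (fun t => sin t - 2 / 3 * sin t ^ 3 + sin t ^ 5 / 5).
  + intros t; auto_derive; [trivial|].
    match goal with |- ?l = _ => replace l with
      (cos t * (1 - 2 * (sin t * sin t) + (sin t * sin t) * (sin t * sin t)))
      by (simpl; field) end.
    rewrite S2; ring.
  + intros t; auto_derive; trivial.
  + now rewrite sin_2PI, sin_0.
Qed.

Lemma is_mean_cos_pow_sin (n : nat) : is_mean (fun t => cos t ^ n * sin t) 0.
Proof.
assert (INR (S n) <> 0) by apply not_0_INR, Nat.neq_succ_0.
apply is_mean_derive with (fun t => - / INR (S n) * cos t ^ S n).
- intros t; auto_derive; [trivial|]; simpl pred; now field.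
- intros t; auto_derive; trivial.
- now rewrite cos_2PI, cos_0.
Qed.

(** * Estimates for the remainder and for the first mode *)

(** Removing the first mode from the equation leaves a delay equation for [w] forced only by the
    nonlinearity. Replacing [nu] by 1 and [th] by [PI / 2] costs a small multiple of sup [w], which
    is absorbed. The bound is in terms of sup [y], since no comparison of that with [A] is available
    yet. *)
Lemma remainder_bound (F y : R -> R) (nu th A E K : R) :
  (forall z, ex_derive F z) -> periodic y ->
  (forall t, is_derive y t (- nu * F (y (t - th)))) ->
  Rabs (nu - 1) <= 1 / 204 -> Rabs (th - PI / 2) <= 1 / 204 ->
  (forall t, Rabs (y t) <= E) -> (forall t, Rabs (F (y t) - y t) <= K * E ^ 2) ->
  is_mean (fun t => y t * cos t) (A / 2) -> is_mean (fun t => y t * sin t) 0 ->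
  forall t, Rabs (y t - A * cos t) <= 1360 * (K * E ^ 2).
Proof.
intros DF Py Dy Hnu Hth HE HN Hc Hs.
set (n := fun t => F (y t) - y t) in *.
set (N := K * E ^ 2) in *.
assert (N0 : 0 <= N) by (eapply Rle_trans; [apply Rabs_pos | apply (HN 0)]).
assert (Ey : forall t, ex_derive y t) by (intros; eexists; apply Dy).
destruct (ex_mean (fun t => F (y t) * cos t)) as [Fa HFa];
  [intros; auto_derive; repeat split; trivial|].
destruct (ex_mean (fun t => F (y t) * sin t)) as [Fb HFb];
  [intros; auto_derive; repeat split; trivial|].
assert (one : forall (h g : R -> R) v, is_mean (fun t => h t * g t) v -> is_mean (fun t => h t * g (1 * t)) v).
{ intros h g v; apply is_mean_ext; intros; now rewrite Rmult_1_l. }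
destruct (mode_equation F y nu th 1 (A / 2) 0 Fa Fb) as [E1 E2]; trivial;
  try (now apply one); try (rewrite Rmult_1_l; apply cos_2PI || apply sin_2PI).
rewrite (Rmult_1_l th) in E1, E2.
assert (cb : forall s, Rabs (cos s) <= 1) by (intros; apply Rabs_le, COS_bound).
assert (sb : forall s, Rabs (sin s) <= 1) by (intros; apply Rabs_le, SIN_bound).
assert (Na : Rabs (Fa - A / 2) <= N * 1).
{ replace (Fa - A / 2) with (Fa + (-1) * (A / 2)) by ring.
  apply (is_mean_bound _ _ _ (is_mean_plus _ _ _ _ HFa (is_mean_scal (-1) _ _ Hc))).
  intros s _; replace (F (y s) * cos s + -1 * (y s * cos s)) with (n s * cos s)
    by (unfold n; ring).
  apply Rabs_mult_le; [apply HN | apply cb]. }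
assert (Nb : Rabs Fb <= N * 1).
{ replace Fb with (Fb + (-1) * 0) by ring.
  apply (is_mean_bound _ _ _ (is_mean_plus _ _ _ _ HFb (is_mean_scal (-1) _ _ Hs))).
  intros s _; replace (F (y s) * sin s + -1 * (y s * sin s)) with (n s * sin s)
    by (unfold n; ring).
  apply Rabs_mult_le; [apply HN | apply sb]. }
rewrite Rmult_1_r in Na, Nb.
set (w := fun t => y t - A * cos t).
(* This is [- nu] times the delayed nonlinear part [n] with its own first mode removed; [Fa - A / 2]
   and [Fb] are the cosine and sine means of [n]. The removed mode costs at most [8 * N]. *)
set (g := fun t => - nu * (n (t - th) + 2 * ((Fb * sin th - (Fa - A / 2) * cos th) * cos t
                    - (Fb * cos th + (Fa - A / 2) * sin th) * sin t))).
assert (nub : Rabs nu <= 205 / 204) by (apply Rabs_le; apply Rabs_le_between in Hnu; lra).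
assert (nu0 : 0 < nu) by (apply Rabs_le_between in Hnu; lra).
assert (Hg : forall t, Rabs (g t) <= 10 * N).
{ intros t; unfold g.
  assert (M : forall a b, Rabs a <= N -> Rabs b <= N -> forall u v r, Rabs u <= 1 -> Rabs v <= 1 -> Rabs r <= 1 ->
     Rabs ((a * u + b * v) * r) <= 2 * N).
  { intros a b Ha Hb u v r Hu Hv Hr.
    replace (2 * N) with ((N * 1 + N * 1) * 1) by ring.
    apply Rabs_mult_le; trivial.
    eapply Rle_trans; [apply Rabs_triang|].
    apply Rplus_le_compat; now apply Rabs_mult_le. }
  assert (Na' : Rabs (- (Fa - A / 2)) <= N) by now rewrite Rabs_Ropp.
  pose proof (M _ _ Nb Na' (sin th) (cos th) (cos t) (sb _) (cb _) (cb _)) as M1.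
  pose proof (M _ _ Nb Na (cos th) (sin th) (sin t) (cb _) (sb _) (sb _)) as M2.
  pose proof (HN (t - th)) as M3.
  eapply Rle_trans with ((205 / 204) * (9 * N)); [|lra].
  apply Rabs_mult_le; [now rewrite Rabs_Ropp|].
  apply Rabs_le; apply Rabs_le_between in M1, M2, M3; fold (n (t - th)) in M3; lra. }
assert (Dw : forall t, is_derive w t (- nu * w (t - th) + g t)).
{ intros t; unfold w; auto_derive; [apply Ey|].
  assert (Dy1 : Derive (fun x => y x) t = - nu * F (y (t - th)))
    by apply is_derive_unique, Dy.
  rewrite Dy1; unfold g, n; rewrite (cos_minus t th).
  pose proof (f_equal (Rmult (2 * cos t)) E1); pose proof (f_equal (Rmult (2 * sin t)) E2).
  lra. }
assert (Pw : periodic w).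
{ intros t; unfold w; rewrite Py, cos_plus, cos_2PI, sin_2PI; ring. }
destruct (sup_abs w (E + Rabs A * 1)) as [W [HW LW]].
{ intros t; unfold w; eapply Rle_trans; [apply Rabs_triang|].
  apply Rplus_le_compat; [apply HE|]; rewrite Rabs_Ropp; apply Rabs_mult_le; [lra | apply cb]. }
assert (W0 : 0 <= W) by (eapply Rle_trans; [apply Rabs_pos | apply (HW 0)]).
assert (Lw : forall t, Rabs (- nu * w (t - th) + g t) <= 205 / 204 * W + 10 * N).
{ intros t; eapply Rle_trans; [apply Rabs_triang|]; apply Rplus_le_compat; [|apply Hg].
  apply Rabs_mult_le; [now rewrite Rabs_Ropp | apply HW]. }
destruct is_mean_cos_pow as [_ [M2 _]].
pose proof (is_mean_cos_pow_sin 1) as M11.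
(* The forcing collects the change of delay, controlled by the Lipschitz constant [Lw], the change
   of [nu], and [g]. Since [204 = 6 * 34], the coefficient of [W] after multiplication by 34 is 1/2,
   and solving for [W] gives [1360 = 2 * 34 * 20]. *)
assert (Q := quarter_delay_bound w (fun t => w (t - PI / 2) - nu * w (t - th) + g t)
   (3 / 204 * W + 20 * N) Pw).
enough (W <= 34 * (3 / 204 * W + 20 * N)) by (intros t; eapply Rle_trans; [apply HW|]; lra).
apply LW, Q.
- intros t; replace (- w (t - PI / 2) + (w (t - PI / 2) - nu * w (t - th) + g t))
    with (- nu * w (t - th) + g t) by ring; apply Dw.
- intros t; pose proof (Hg t) as B1.
  assert (B2 := Rabs_mult_le _ _ _ _ Hnu (HW (t - th))).
  assert (B3 := lipschitz_of_derive w _ _ Dw Lw (t - th) (t - PI / 2)).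
  replace (t - PI / 2 - (t - th)) with (th - PI / 2) in B3 by ring.
  assert (B4 : (205 / 204 * W + 10 * N) * Rabs (th - PI / 2) <= (205 / 204 * W + 10 * N) * (1 / 204))
    by (apply Rmult_le_compat_l; lra).
  apply Rabs_le; apply Rabs_le_between in B1, B2.
  assert (B5 := Rle_trans _ _ _ B3 B4); apply Rabs_le_between in B5; lra.
- replace 0 with (A / 2 + - A * (1 / 2)) by field.
  eapply is_mean_ext; [|exact (is_mean_plus _ _ _ _ Hc (is_mean_scal (- A) _ _ M2))].
  intros t; unfold w; simpl; ring.
- replace 0 with (0 + - A * 0) by ring.
  eapply is_mean_ext; [|exact (is_mean_plus _ _ _ _ Hs (is_mean_scal (- A) _ _ M11))].
  intros t; unfold w; simpl; ring.
Qed.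

(* The quantities are the Fourier means of w = y - A cos and of the Taylor error e of F(y):
   m, p, q are those of w against 1, cos 2t, sin 2t, and Fc, Fs those of F(y) against
   cos 2t, sin 2t; nC and nS stand for nu cos(2 th) and nu sin(2 th), close to -1 and 0.
   The equations force m ~ - B A^2 / 2, p ~ - B A^2 / 20, and the squared first mode of F(y)
   becomes A^2 / 4 - ka A^4 + o(A^4) with ka = 11/20 B^2 - 3/8 C > 0. *)
Lemma first_mode_decay (B C L K : R) :
  C < 22 / 15 * B ^ 2 -> 0 <= L -> 0 <= K ->
  exists s0, 0 < s0 <= 1 /\
  forall s A m p q r2c r2s e0 e1c e1s e2c e2s Fc Fs nC nS,
  0 < s <= s0 -> 0 < A <= 2 * s ->
  Rabs p <= L * A ^ 2 -> Rabs q <= L * A ^ 2 ->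
  Rabs r2c <= L * A ^ 2 -> Rabs r2s <= L * A ^ 2 ->
  Rabs e0 <= s * K * A ^ 3 -> Rabs e1c <= s * K * A ^ 3 -> Rabs e1s <= s * K * A ^ 3 ->
  Rabs e2c <= s * K * A ^ 3 -> Rabs e2s <= s * K * A ^ 3 ->
  Rabs (nC + 1) <= 3 * s -> Rabs nS <= 4 * s ->
  m + B * A ^ 2 / 2 + e0 = 0 ->
  Fc = p + B * A ^ 2 / 4 + 2 * A * B * r2c + e2c ->
  Fs = q + 2 * A * B * r2s + e2s ->
  2 * q = - (Fc * nC - Fs * nS) -> 2 * p = Fs * nC + Fc * nS ->
  (A / 2 + 3 / 8 * C * A ^ 3 + A * B * (m + p) + e1c) ^ 2 + (A * B * q + e1s) ^ 2 <= (A / 2) ^ 2.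
Proof.
intros HC L0 K0; set (b := Rabs B).
assert (b0 : 0 <= b) by apply Rabs_pos.
set (K2 := 4 * b * L + 2 * K); set (K3 := L + b + K2); set (K4 := 21 * K3 + 3 * K2).
set (K5 := b * (2 * K + K4) + K); set (K6 := b * L + K).
assert (bL : 0 <= b * L) by now apply Rmult_le_pos.
assert (P2 : 0 <= K2) by (unfold K2; lra).
assert (P3 : 0 <= K3) by (unfold K3; lra).
assert (P4 : 0 <= K4) by (unfold K4; lra).
assert (P5 : 0 <= K5) by (unfold K5; pose proof (Rmult_le_pos b (2 * K + K4)); lra).
assert (P6 : 0 <= K6) by (unfold K6; lra).
set (ka := 11 / 20 * B ^ 2 - 3 / 8 * C).
assert (ka0 : 0 < ka) by (unfold ka; lra).
assert (D1 : 0 < 2 * (K5 + 1)) by lra.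
assert (D2 : 0 < 8 * (9 / 4 * ka ^ 2 + K6 ^ 2 + 1)) by nra.
(* The first quotient keeps the error [z] in the decay coefficient below [ka / 2]; the second makes
   the terms of order [A ^ 6] smaller than the decay of order [A ^ 4]. *)
exists (Rmin 1 (Rmin (ka / (2 * (K5 + 1))) (ka / (8 * (9 / 4 * ka ^ 2 + K6 ^ 2 + 1))))).
split.
{ split; [|apply Rmin_l].
  apply Rmin_pos; [lra|]; apply Rmin_pos; now apply Rdiv_lt_0_compat. }
intros s A m p q r2c r2s e0 e1c e1s e2c e2s Fc Fs nC nS [s0 Hs] [A0 HA]
  Hp Hq Hr2c Hr2s He0 He1c He1s He2c He2s HnC HnS Em EFc EFs Eq Ep.
assert (s1 : s <= 1) by (eapply Rle_trans; [exact Hs | apply Rmin_l]).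
assert (Hs1 : s * (2 * (K5 + 1)) <= ka).
{ apply Rle_div_r; [lra|]; eapply Rle_trans; [exact Hs|].
  eapply Rle_trans; [apply Rmin_r | apply Rmin_l]. }
assert (Hs2 : s * (8 * (9 / 4 * ka ^ 2 + K6 ^ 2 + 1)) <= ka).
{ apply Rle_div_r; [lra|]; eapply Rle_trans; [exact Hs|].
  eapply Rle_trans; [apply Rmin_r | apply Rmin_r]. }
clear Hs.
set (a2 := A ^ 2) in *.
assert (a20 : 0 < a2) by (unfold a2; nra).
assert (A3 : A ^ 3 = A * a2) by (unfold a2; ring).
rewrite A3 in *.
assert (Aa2 : 0 < A * a2) by nra.
assert (Bb : Rabs B <= b) by apply Rle_refl.
assert (Ab : Rabs A <= A) by (rewrite Rabs_right; lra).
assert (small : s * K * (A * a2) <= s * (2 * K) * a2).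
{ assert (A <= 2) by lra.
  replace (s * (2 * K) * a2) with ((s * K * a2) * 2) by ring.
  replace (s * K * (A * a2)) with ((s * K * a2) * A) by ring.
  apply Rmult_le_compat_l; [|lra]; repeat apply Rmult_le_pos; lra. }
assert (HX : Rabs (Fc - p - B * a2 / 4) <= s * K2 * a2).
{ replace (Fc - p - B * a2 / 4) with (2 * (A * (B * r2c)) + e2c) by (rewrite EFc; field).
  assert (T := Rabs_mult_le _ _ _ _ Ab (Rabs_mult_le _ _ _ _ Bb Hr2c)).
  assert (A * (b * (L * a2)) <= (2 * s) * (b * (L * a2)))
    by (apply Rmult_le_compat_r; [repeat apply Rmult_le_pos; lra | lra]).
  apply Rabs_le; apply Rabs_le_between in T, He2c; unfold K2; lra. }
assert (HY : Rabs (Fs - q) <= s * K2 * a2).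
{ replace (Fs - q) with (2 * (A * (B * r2s)) + e2s) by (rewrite EFs; ring).
  assert (T := Rabs_mult_le _ _ _ _ Ab (Rabs_mult_le _ _ _ _ Bb Hr2s)).
  assert (A * (b * (L * a2)) <= (2 * s) * (b * (L * a2)))
    by (apply Rmult_le_compat_r; [repeat apply Rmult_le_pos; lra | lra]).
  apply Rabs_le; apply Rabs_le_between in T, He2s; unfold K2; lra. }
assert (sK2 : s * K2 * a2 <= K2 * a2).
{ apply Rmult_le_compat_r; [lra|]; rewrite <- (Rmult_1_l K2) at 2.
  now apply Rmult_le_compat_r. }
assert (ba2 : 0 <= b * a2) by (apply Rmult_le_pos; lra).
assert (HFc : Rabs Fc <= K3 * a2).
{ assert (T : Rabs (B * a2) <= b * a2).
  { apply Rabs_mult_le; [trivial|]; rewrite Rabs_right; lra. }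
  apply Rabs_le; apply Rabs_le_between in T, HX, Hp; unfold K3; lra. }
assert (HFs : Rabs Fs <= K3 * a2).
{ apply Rabs_le; apply Rabs_le_between in HY, Hq; unfold K3; lra. }
assert (HU : Rabs (2 * q - Fc) <= 7 * s * (K3 * a2)).
{ replace (2 * q - Fc) with (- ((nC + 1) * Fc) + nS * Fs) by (rewrite Eq; ring).
  assert (T1 := Rabs_mult_le _ _ _ _ HnC HFc).
  assert (T2 := Rabs_mult_le _ _ _ _ HnS HFs).
  apply Rabs_le; apply Rabs_le_between in T1, T2; lra. }
assert (HV : Rabs (2 * p + Fs) <= 7 * s * (K3 * a2)).
{ replace (2 * p + Fs) with ((nC + 1) * Fs + nS * Fc) by (rewrite Ep; ring).
  assert (T1 := Rabs_mult_le _ _ _ _ HnC HFs).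
  assert (T2 := Rabs_mult_le _ _ _ _ HnS HFc).
  apply Rabs_le; apply Rabs_le_between in T1, T2; lra. }
(* In the limit [2 * q = Fc], [2 * p = - Fs], [Fc = p + B * a2 / 4] and [Fs = q]. Eliminating all
   but [p] gives [5 * p = - B * a2 / 4]; the same combination of the four errors gives [K4]. *)
assert (Hp20 : Rabs (p + B * a2 / 20) <= s * K4 * a2).
{ apply Rabs_le; apply Rabs_le_between in HX, HY, HU, HV.
  assert (0 <= s * K4 * a2) by (repeat apply Rmult_le_pos; lra).
  unfold K4 in *; lra. }
assert (HZ : exists z, Rabs z <= s * K5 /\
  A / 2 + 3 / 8 * C * (A * a2) + A * B * (m + p) + e1c = A / 2 - (ka - z) * (A * a2)).
{ exists ((A * (B * (p + B * a2 / 20 - e0)) + e1c) / (A * a2)); split.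
  - unfold Rdiv; rewrite Rabs_mult, (Rabs_right (/ (A * a2)))
      by (apply Rle_ge, Rlt_le, Rinv_0_lt_compat; lra).
    apply Rle_div_l; [lra|].
    assert (T0 : Rabs (p + B * a2 / 20 - e0) <= s * K4 * a2 + s * (2 * K) * a2).
    { apply Rabs_le; apply Rabs_le_between in Hp20, He0; lra. }
    assert (T := Rabs_mult_le _ _ _ _ Ab (Rabs_mult_le _ _ _ _ Bb T0)).
    apply Rabs_le; apply Rabs_le_between in T, He1c; unfold K5; lra.
  - replace m with (- (B * a2 / 2) - e0) by lra.
    unfold ka; replace (B ^ 2) with (B * B) by ring; fold a2; field; lra. }
destruct HZ as [z [Hz ->]].
(* The sine part enters only through its square, of order [A ^ 6], so boundedness of [v] is enough
   and no smallness in [s] is sought. *)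
assert (HW : exists v, Rabs v <= K6 /\ A * B * q + e1s = v * (A * a2)).
{ exists ((A * (B * q) + e1s) / (A * a2)); split; [|field; lra].
  unfold Rdiv; rewrite Rabs_mult, (Rabs_right (/ (A * a2)))
    by (apply Rle_ge, Rlt_le, Rinv_0_lt_compat; lra).
  apply Rle_div_l; [lra|].
  assert (T := Rabs_mult_le _ _ _ _ Ab (Rabs_mult_le _ _ _ _ Bb Hq)).
  assert (s * K * (A * a2) <= 1 * (K * (A * a2))).
  { rewrite Rmult_assoc; apply Rmult_le_compat_r; [apply Rmult_le_pos; lra | lra]. }
  apply Rabs_le; apply Rabs_le_between in T, He1s; unfold K6; lra. }
destruct HW as [v [Hv ->]].
set (c := ka - z).
assert (Hc : ka / 2 <= c <= 3 / 2 * ka).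
{ apply Rabs_le_between in Hz; unfold c; lra. }
assert (Hv2 : v ^ 2 <= K6 ^ 2).
{ rewrite <- (pow2_abs v); apply pow_incr; split; [apply Rabs_pos | exact Hv]. }
assert (Hc2 : c ^ 2 <= 9 / 4 * ka ^ 2) by nra.
assert (a2s : a2 <= 4 * s) by (unfold a2; nra).
assert (G : a2 * (c ^ 2 + v ^ 2) <= c).
{ assert (0 <= c ^ 2 + v ^ 2) by nra.
  assert (a2 * (c ^ 2 + v ^ 2) <= (4 * s) * (9 / 4 * ka ^ 2 + K6 ^ 2 + 1)).
  { apply Rmult_le_compat; lra. }
  lra. }
replace ((A / 2 - c * (A * a2)) ^ 2 + (v * (A * a2)) ^ 2)
  with ((A / 2) ^ 2 - a2 * a2 * (c - a2 * (c ^ 2 + v ^ 2))) by (unfold a2; field).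
assert (0 <= a2 * a2 * (c - a2 * (c ^ 2 + v ^ 2))) by (repeat apply Rmult_le_pos; lra).
lra.
Qed.

(** * The frequency bound for small periodic solutions *)

(** Tests the expansion of [F (A * cos t + w t)] against [g]. With [w = O(A ^ 2)], the square of [w]
    and the cubic terms containing [w] have order at least [A ^ 4] and are left to [e]. *)
Lemma is_mean_expansion (g e w x : R -> R) (A B C a1 a2 a3 b0 b1 e0 : R) :
  (forall t, x t = A * cos t + w t + B * (A ^ 2 * cos t ^ 2 + 2 * A * (cos t * w t))
                   + C * (A ^ 3 * cos t ^ 3) + e t) ->
  is_mean (fun t => cos t ^ 1 * g t) a1 -> is_mean (fun t => cos t ^ 2 * g t) a2 ->
  is_mean (fun t => cos t ^ 3 * g t) a3 -> is_mean (fun t => w t * g t) b0 ->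
  is_mean (fun t => w t * (cos t * g t)) b1 -> is_mean (fun t => e t * g t) e0 ->
  is_mean (fun t => x t * g t)
    (A * a1 + b0 + B * A ^ 2 * a2 + 2 * A * B * b1 + C * A ^ 3 * a3 + e0).
Proof.
intros Ex H1 H2 H3 Hb0 Hb1 He.
eapply is_mean_ext; [|exact (is_mean_plus _ _ _ _ (is_mean_plus _ _ _ _ (is_mean_plus _ _ _ _
  (is_mean_plus _ _ _ _ (is_mean_plus _ _ _ _ (is_mean_scal _ _ _ H1) Hb0)
  (is_mean_scal _ _ _ H2)) (is_mean_scal _ _ _ Hb1)) (is_mean_scal _ _ _ H3)) He)].
intros t; simpl; rewrite Ex; ring.
Qed.

Lemma frequency_bound_in_phase (B C : R) :
  C < 22 / 15 * B ^ 2 ->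
  exists s, 0 < s <= 1 / 204 /\
  forall (F y : R -> R) (nu th A : R),
  (forall z, ex_derive F z) -> periodic y ->
  (forall t, is_derive y t (- nu * F (y (t - th)))) ->
  Rabs (nu - 1) <= s -> Rabs (th - PI / 2) <= s ->
  (forall t, Rabs (y t) <= s) ->
  (forall t, Rabs (F (y t) - (y t + B * y t ^ 2 + C * y t ^ 3)) <= s * Rabs (y t) ^ 3) ->
  (exists t, y t <> 0) ->
  0 <= A -> is_mean (fun t => y t * cos t) (A / 2) -> is_mean (fun t => y t * sin t) 0 ->
  1 <= nu.
Proof.
intros HBC.
set (K := Rabs B + Rabs C + 1).
pose proof (Rabs_pos B) as B0; pose proof (Rabs_pos C) as C0.
assert (K1 : 1 <= K) by (unfold K; lra).
(* [5440 = 4 * 1360]: the remainder bound in terms of sup [y] is converted through sup [y] at most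
   [2 * A]. In [Ke], the 8 comes from the Taylor error at [2 * A], the other two terms from
   [B * w ^ 2] and the cubic terms with [w], where one factor [A <= 2 * s] is traded for [s]. *)
set (L := 5440 * K).
set (Ke := 8 + 2 * Rabs B * L ^ 2 + 14 * Rabs C * L).
assert (L1 : 1 <= L) by (unfold L; lra).
assert (Ke0 : 0 <= Ke).
{ unfold Ke; pose proof (Rmult_le_pos _ (L ^ 2) B0); pose proof (Rmult_le_pos _ L C0); nra. }
destruct (first_mode_decay B C L Ke) as [s0 [[s00 s01] FMD]]; [trivial|lra|trivial|].
set (s := Rmin s0 (1 / (2720 * K))).
assert (ss0 : s <= s0) by apply Rmin_l.
assert (sK : s * (2720 * K) <= 1).
{ apply Rle_div_r; [lra | apply Rmin_r]. }
assert (s_pos : 0 < s).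
{ apply Rmin_pos; [trivial | apply Rdiv_lt_0_compat; lra]. }
assert (s204 : s <= 1 / 204) by nra.
exists s; split; [lra|].
intros F y nu th A DF Py Dy Hnu Hth Hy HF [t0 Ht0] A0 Hc Hsn.
assert (Ey : forall t, ex_derive y t) by (intros; eexists; apply Dy).
destruct (sup_abs y s Hy) as [E [HE LE]].
assert (E0 : 0 < E).
{ apply Rlt_le_trans with (Rabs (y t0)); [now apply Rabs_pos_lt | apply HE]. }
assert (Es : E <= s) by now apply LE.
assert (absp : forall a b n, Rabs a <= b -> Rabs (a ^ n) <= b ^ n).
{ intros a b n Hab; rewrite <- RPow_abs; apply pow_incr; split; [apply Rabs_pos | trivial]. }
assert (HN : forall t, Rabs (F (y t) - y t) <= K * E ^ 2).
{ intros t; replace (F (y t) - y t) with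
    (F (y t) - (y t + B * y t ^ 2 + C * y t ^ 3) + B * y t ^ 2 + C * y t ^ 3) by ring.
  pose proof (HF t) as T1.
  assert (Bb := Rle_refl (Rabs B)); assert (Cb := Rle_refl (Rabs C)).
  assert (T2 := Rabs_mult_le _ _ _ _ Bb (absp _ _ 2%nat (HE t))).
  assert (T3 := Rabs_mult_le _ _ _ _ Cb (absp _ _ 3%nat (HE t))).
  assert (T4 : s * Rabs (y t) ^ 3 <= 1 * E ^ 3).
  { apply Rmult_le_compat; [lra | apply pow_le, Rabs_pos | lra |].
    apply pow_incr; split; [apply Rabs_pos | apply HE]. }
  assert (E3 : E ^ 3 <= E ^ 2) by nra.
  assert (T5 : Rabs C * E ^ 3 <= Rabs C * E ^ 2) by now apply Rmult_le_compat_l.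
  apply Rabs_le; apply Rabs_le_between in T1, T2, T3; unfold K; lra. }
set (w := fun t => y t - A * cos t).
assert (HwE : forall t, Rabs (w t) <= 1360 * (K * E ^ 2)).
{ intros t; apply (remainder_bound F y nu th A E K); trivial; lra. }
assert (cb : forall t, Rabs (cos t) <= 1) by (intros; apply Rabs_le, COS_bound).
assert (sb : forall t, Rabs (sin t) <= 1) by (intros; apply Rabs_le, SIN_bound).
assert (Ab : Rabs A <= A) by (rewrite Rabs_right; lra).
(* The restriction [s <= 1 / (2720 * K)] is made for this: it turns [1360 * (K * E ^ 2)] into at
   most [E / 2]. It also shows that [A] is positive. *)
assert (EA : E <= 2 * A).
{ assert (E <= A * 1 + 1360 * (K * E ^ 2)).
  { apply LE; intros t; replace (y t) with (A * cos t + w t) by (unfold w; ring).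
    eapply Rle_trans; [apply Rabs_triang|]; apply Rplus_le_compat; [|apply HwE].
    apply Rabs_mult_le; trivial. }
  assert (E * (2720 * K) <= s * (2720 * K)) by (apply Rmult_le_compat_r; lra).
  nra. }
assert (Apos : 0 < A) by lra.
assert (Hw : forall t, Rabs (w t) <= L * A ^ 2).
{ intros t; eapply Rle_trans; [apply HwE|]; unfold L.
  assert (E ^ 2 <= 4 * A ^ 2) by nra.
  assert (K * E ^ 2 <= K * (4 * A ^ 2)) by (apply Rmult_le_compat_l; lra). lra. }
assert (As : A <= 2 * s).
{ assert (T : Rabs (A / 2) <= s * 1).
  { apply (is_mean_bound _ _ _ Hc); intros; now apply Rabs_mult_le. }
  apply Rabs_le_between in T; lra. }
set (e := fun t => F (y t) - (A * cos t + w t + B * (A ^ 2 * cos t ^ 2 + 2 * A * (cos t * w t))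
                   + C * (A ^ 3 * cos t ^ 3))).
assert (Hx : forall t, F (y t) = A * cos t + w t + B * (A ^ 2 * cos t ^ 2 + 2 * A * (cos t * w t))
                   + C * (A ^ 3 * cos t ^ 3) + e t) by (intros; unfold e; ring).
assert (He : forall t, Rabs (e t) <= s * Ke * A ^ 3).
{ intros t.
  assert (yA : Rabs (y t) <= 2 * A) by (pose proof (HE t); lra).
  replace (e t) with (F (y t) - (y t + B * y t ^ 2 + C * y t ^ 3) + B * w t ^ 2
     + C * (w t * (y t ^ 2 + y t * (A * cos t) + (A * cos t) ^ 2))) by (unfold e, w; ring).
  pose proof (HF t) as T1.
  assert (T1' : s * Rabs (y t) ^ 3 <= s * (2 * A) ^ 3).
  { apply Rmult_le_compat_l; [lra|]; apply pow_incr; split; [apply Rabs_pos | trivial]. }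
  assert (Bb := Rle_refl (Rabs B)); assert (Cb := Rle_refl (Rabs C)).
  assert (T2 := Rabs_mult_le _ _ _ _ Bb (absp _ _ 2%nat (Hw t))).
  assert (T2' : Rabs B * (L * A ^ 2) ^ 2 <= s * (2 * Rabs B * L ^ 2) * A ^ 3).
  { replace (Rabs B * (L * A ^ 2) ^ 2) with ((Rabs B * L ^ 2 * A ^ 3) * A) by ring.
    replace (s * (2 * Rabs B * L ^ 2) * A ^ 3) with ((Rabs B * L ^ 2 * A ^ 3) * (2 * s)) by ring.
    apply Rmult_le_compat_l; [|trivial].
    repeat apply Rmult_le_pos; first [lra | apply pow_le; lra]. }
  assert (Q : Rabs (y t ^ 2 + y t * (A * cos t) + (A * cos t) ^ 2) <= 7 * A ^ 2).
  { assert (Ac : Rabs (A * cos t) <= A * 1) by now apply Rabs_mult_le.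
    assert (Q1 := absp _ _ 2%nat yA); assert (Q2 := absp _ _ 2%nat Ac).
    assert (Q3 := Rabs_mult_le _ _ _ _ yA Ac).
    apply Rabs_le; apply Rabs_le_between in Q1, Q2, Q3; lra. }
  assert (T3 := Rabs_mult_le _ _ _ _ Cb (Rabs_mult_le _ _ _ _ (Hw t) Q)).
  assert (T3' : Rabs C * (L * A ^ 2 * (7 * A ^ 2)) <= s * (14 * Rabs C * L) * A ^ 3).
  { replace (Rabs C * (L * A ^ 2 * (7 * A ^ 2))) with ((Rabs C * L * 7 * A ^ 3) * A) by ring.
    replace (s * (14 * Rabs C * L) * A ^ 3) with ((Rabs C * L * 7 * A ^ 3) * (2 * s)) by ring.
    apply Rmult_le_compat_l; [|trivial].
    repeat apply Rmult_le_pos; first [lra | apply pow_le; lra]. }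
  apply Rabs_le; apply Rabs_le_between in T1, T2, T3; unfold Ke; lra. }
assert (Dw : forall t, ex_derive w t).
{ intros t; unfold w; auto_derive; apply Ey. }
assert (De : forall t, ex_derive e t).
{ intros t; unfold e; auto_derive; repeat split; trivial. }
assert (mw : forall g, (forall t, Rabs (g t) <= 1) -> (forall t, ex_derive g t) ->
   exists v, is_mean (fun t => w t * g t) v /\ Rabs v <= L * A ^ 2).
{ intros g Hg Dg; destruct (ex_mean (fun t => w t * g t)) as [v Hv].
  - intros; auto_derive; repeat split; trivial.
  - exists v; split; [trivial|]; apply (is_mean_bound _ _ _ Hv); intros t _.
    rewrite <- (Rmult_1_r (L * A ^ 2)); now apply Rabs_mult_le. }
assert (me : forall g, (forall t, Rabs (g t) <= 1) -> (forall t, ex_derive g t) ->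
   exists v, is_mean (fun t => e t * g t) v /\ Rabs v <= s * Ke * A ^ 3).
{ intros g Hg Dg; destruct (ex_mean (fun t => e t * g t)) as [v Hv].
  - intros; auto_derive; repeat split; trivial.
  - exists v; split; [trivial|]; apply (is_mean_bound _ _ _ Hv); intros t _.
    rewrite <- (Rmult_1_r (s * Ke * A ^ 3)); now apply Rabs_mult_le. }
assert (c2b : forall t, Rabs (cos (2 * t)) <= 1) by (intros; apply cb).
assert (s2b : forall t, Rabs (sin (2 * t)) <= 1) by (intros; apply sb).
assert (cc2b : forall t, Rabs (cos t * cos (2 * t)) <= 1).
{ intros; rewrite <- (Rmult_1_r 1); now apply Rabs_mult_le. }
assert (cs2b : forall t, Rabs (cos t * sin (2 * t)) <= 1).
{ intros; rewrite <- (Rmult_1_r 1); now apply Rabs_mult_le. }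
destruct (mw (fun _ => 1)) as [m [Mm _]];
  [intros; rewrite Rabs_R1; lra | intros; apply ex_derive_const |].
destruct (mw (fun t => cos (2 * t))) as [p [Mp Hp]]; [trivial | intros; auto_derive; trivial |].
destruct (mw (fun t => sin (2 * t))) as [q [Mq Hq]]; [trivial | intros; auto_derive; trivial |].
destruct (mw (fun t => cos t * cos (2 * t))) as [r2c [Mr2c Hr2c]];
  [trivial | intros; auto_derive; trivial |].
destruct (mw (fun t => cos t * sin (2 * t))) as [r2s [Mr2s Hr2s]];
  [trivial | intros; auto_derive; trivial |].
destruct (me (fun _ => 1)) as [e0 [Me0 He0]];
  [intros; rewrite Rabs_R1; lra | intros; apply ex_derive_const |].
destruct (me cos) as [e1c [Me1c He1c]]; [trivial | intros; auto_derive; trivial |].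
destruct (me sin) as [e1s [Me1s He1s]]; [trivial | intros; auto_derive; trivial |].
destruct (me (fun t => cos (2 * t))) as [e2c [Me2c He2c]]; [trivial | intros; auto_derive; trivial |].
destruct (me (fun t => sin (2 * t))) as [e2s [Me2s He2s]]; [trivial | intros; auto_derive; trivial |].
destruct is_mean_cos_pow as [M1 [M2 [M3 [M4 M5]]]].
pose proof is_mean_cos_pow_sin as MS.
assert (lin : forall (f g h : R -> R) a b u v r, is_mean f u -> is_mean g v ->
   (forall t, h t = a * f t + b * g t) -> r = a * u + b * v -> is_mean h r).
{ intros f g h a b u v r Hf Hg Eh ->; eapply is_mean_ext; [intros t; symmetry; apply Eh|].
  apply is_mean_plus; now apply is_mean_scal. }
assert (Mwc : is_mean (fun t => w t * cos t) 0).
{ apply (lin _ _ _ 1 (- A) _ _ _ Hc M2); [intros; unfold w; ring | field]. }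
assert (Mws : is_mean (fun t => w t * sin t) 0).
{ apply (lin _ _ _ 1 (- A) _ _ _ Hsn (MS 1%nat)); [intros; unfold w; ring | field]. }
assert (C2 : forall t, cos (2 * t) = 2 * cos t ^ 2 - 1).
{ intros; rewrite cos_2a_cos; ring. }
assert (S2 : forall t, sin (2 * t) = 2 * sin t * cos t) by (intros; apply sin_2a).
assert (Mcc2 : is_mean (fun t => cos t * cos (2 * t)) 0).
{ apply (lin _ _ _ 2 (-1) _ _ _ M3 M1); [intros; rewrite C2; simpl | ]; ring. }
assert (Mcs2 : is_mean (fun t => cos t * sin (2 * t)) 0).
{ apply (lin _ _ _ 2 0 _ _ _ (MS 2%nat) M1); [intros; rewrite S2; simpl | ]; ring. }
assert (X0 : is_mean (fun t => F (y t) * 1) (m + B * A ^ 2 / 2 + e0)).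
{ replace (m + B * A ^ 2 / 2 + e0) with
    (A * 0 + m + B * A ^ 2 * (1 / 2) + 2 * A * B * 0 + C * A ^ 3 * 0 + e0) by field.
  apply (is_mean_expansion (fun _ => 1) e w (fun t => F (y t))); trivial.
  - eapply is_mean_ext; [|exact M1]; intros; simpl; ring.
  - eapply is_mean_ext; [|exact M2]; intros; simpl; ring.
  - eapply is_mean_ext; [|exact M3]; intros; simpl; ring.
  - eapply is_mean_ext; [|exact Mwc]; intros; simpl; ring. }
assert (X1c : is_mean (fun t => F (y t) * cos t)
   (A / 2 + 3 / 8 * C * A ^ 3 + A * B * (m + p) + e1c)).
{ replace (A / 2 + 3 / 8 * C * A ^ 3 + A * B * (m + p) + e1c) with
    (A * (1 / 2) + 0 + B * A ^ 2 * 0 + 2 * A * B * ((m + p) / 2) + C * A ^ 3 * (3 / 8) + e1c) by field.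
  apply (is_mean_expansion cos e w (fun t => F (y t))); trivial.
  - eapply is_mean_ext; [|exact M2]; intros; simpl; ring.
  - eapply is_mean_ext; [|exact M3]; intros; simpl; ring.
  - eapply is_mean_ext; [|exact M4]; intros; simpl; ring.
  - apply (lin _ _ _ (1 / 2) (1 / 2) _ _ _ Mm Mp); [intros; rewrite C2|]; field. }
assert (X1s : is_mean (fun t => F (y t) * sin t) (A * B * q + e1s)).
{ replace (A * B * q + e1s) with
    (A * 0 + 0 + B * A ^ 2 * 0 + 2 * A * B * (q / 2) + C * A ^ 3 * 0 + e1s) by field.
  apply (is_mean_expansion sin e w (fun t => F (y t))); trivial.
  apply (lin _ _ _ (1 / 2) 0 _ _ _ Mq Mp); [intros; rewrite S2|]; field. }
assert (X2c : is_mean (fun t => F (y t) * cos (2 * t))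
   (p + B * A ^ 2 / 4 + 2 * A * B * r2c + e2c)).
{ replace (p + B * A ^ 2 / 4 + 2 * A * B * r2c + e2c) with
    (A * 0 + p + B * A ^ 2 * (1 / 4) + 2 * A * B * r2c + C * A ^ 3 * 0 + e2c) by field.
  apply (is_mean_expansion (fun t => cos (2 * t)) e w (fun t => F (y t))); trivial.
  - apply (lin _ _ _ 2 (-1) _ _ _ M3 M1); [intros; rewrite C2|]; field.
  - apply (lin _ _ _ 2 (-1) _ _ _ M4 M2); [intros; rewrite C2|]; field.
  - apply (lin _ _ _ 2 (-1) _ _ _ M5 M3); [intros; rewrite C2|]; field. }
assert (X2s : is_mean (fun t => F (y t) * sin (2 * t)) (q + 2 * A * B * r2s + e2s)).
{ replace (q + 2 * A * B * r2s + e2s) with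
    (A * 0 + q + B * A ^ 2 * 0 + 2 * A * B * r2s + C * A ^ 3 * 0 + e2s) by field.
  apply (is_mean_expansion (fun t => sin (2 * t)) e w (fun t => F (y t))); trivial.
  - apply (lin _ _ _ 2 0 _ _ _ (MS 2%nat) M1); [intros; rewrite S2; simpl; ring | ring].
  - apply (lin _ _ _ 2 0 _ _ _ (MS 3%nat) M1); [intros; rewrite S2; simpl; ring | ring].
  - apply (lin _ _ _ 2 0 _ _ _ (MS 4%nat) M1); [intros; rewrite S2; simpl; ring | ring]. }
assert (nu0 : 0 < nu) by (apply Rabs_le_between in Hnu; lra).
set (Fc := p + B * A ^ 2 / 4 + 2 * A * B * r2c + e2c) in *.
set (Fs := q + 2 * A * B * r2s + e2s) in *.
set (f1c := A / 2 + 3 / 8 * C * A ^ 3 + A * B * (m + p) + e1c) in *.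
set (f1s := A * B * q + e1s) in *.
assert (c4 : cos (2 * (2 * PI)) = 1) by (rewrite C2, cos_2PI; ring).
assert (s4 : sin (2 * (2 * PI)) = 0) by (rewrite S2, sin_2PI; ring).
(* For [n = 0] the left side of the mode equation vanishes, whatever the mean [v] of [y], so [F y]
   has mean zero. *)
assert (Ey0 : m + B * A ^ 2 / 2 + e0 = 0).
{ destruct (ex_mean (fun t => y t * 1)) as [v Hv]; [intros; auto_derive; repeat split; trivial|].
  destruct (mode_equation F y nu th 0 v 0 (m + B * A ^ 2 / 2 + e0) 0) as [T _]; trivial.
  - rewrite Rmult_0_l; apply cos_0.
  - rewrite Rmult_0_l; apply sin_0.
  - eapply is_mean_ext; [|exact Hv]; intros; rewrite Rmult_0_l, cos_0; ring.
  - eapply is_mean_ext; [|exact (is_mean_const 0)]; intros; rewrite Rmult_0_l, sin_0; ring.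
  - eapply is_mean_ext; [|exact X0]; intros; rewrite Rmult_0_l, cos_0; ring.
  - eapply is_mean_ext; [|exact (is_mean_const 0)]; intros; rewrite Rmult_0_l, sin_0; ring.
  - rewrite (Rmult_0_l th), cos_0, sin_0 in T.
    apply Rmult_eq_reg_l with nu; lra. }
destruct (mode_equation F y nu th 1 (A / 2) 0 f1c f1s) as [T1 T2]; trivial;
  try (rewrite Rmult_1_l; apply cos_2PI || apply sin_2PI);
  try (eapply is_mean_ext; [|first [exact Hc | exact Hsn | exact X1c | exact X1s]];
       intros; simpl; now rewrite Rmult_1_l).
destruct (mode_equation F y nu th 2 p q Fc Fs) as [T3 T4]; trivial.
{ apply (lin _ _ _ A 1 _ _ _ Mcc2 Mp); [intros; unfold w; ring | ring]. }
{ apply (lin _ _ _ A 1 _ _ _ Mcs2 Mq); [intros; unfold w; ring | ring]. }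
assert (Hsum : f1c ^ 2 + f1s ^ 2 <= (A / 2) ^ 2).
{ destruct (cos_sin_lipschitz PI (2 * th)) as [Lc Ls].
  rewrite cos_PI in Lc; rewrite sin_PI in Ls.
  assert (Lth : Rabs (2 * th - PI) <= 2 * s)
    by (apply Rabs_le; apply Rabs_le_between in Hth; lra).
  apply (FMD s A m p q r2c r2s e0 e1c e1s e2c e2s Fc Fs (nu * cos (2 * th)) (nu * sin (2 * th)));
    trivial; try (unfold Fc, Fs; ring); try lra.
  - replace (nu * cos (2 * th) + 1) with ((nu - 1) * cos (2 * th) + (cos (2 * th) - -1)) by ring.
    assert (T5 := Rabs_mult_le _ _ _ _ Hnu (cb (2 * th))).
    assert (T6 := Rle_trans _ _ _ Lc Lth).
    apply Rabs_le; apply Rabs_le_between in T5, T6; lra.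
  - assert (T6 := Rle_trans _ _ _ Ls Lth); rewrite Rminus_0_r in T6.
    replace (4 * s) with (2 * (2 * s)) by ring.
    apply Rabs_mult_le; trivial; apply Rabs_le; apply Rabs_le_between in Hnu; lra. }
rewrite (Rmult_1_l th) in T1, T2.
(* The sum of the squares of the two first-mode equations; the rotation by [th] preserves it. *)
assert (T5 : (A / 2) ^ 2 = nu ^ 2 * (f1c ^ 2 + f1s ^ 2)).
{ pose proof (sin2_cos2 th) as U; unfold Rsqr in U.
  transitivity ((nu * (f1c * cos th - f1s * sin th)) ^ 2 + (nu * (f1s * cos th + f1c * sin th)) ^ 2).
  - replace (nu * (f1c * cos th - f1s * sin th)) with 0 by lra.
    replace (nu * (f1s * cos th + f1c * sin th)) with (A / 2) by lra. ring.
  - transitivity (nu ^ 2 * (f1c ^ 2 + f1s ^ 2) * (sin th * sin th + cos th * cos th)); [ring|].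
    rewrite U; ring. }
destruct (Rle_or_lt 1 nu) as [|Hlt]; [trivial|exfalso].
assert (nu ^ 2 < 1) by nra.
assert (0 < (A / 2) ^ 2) by (apply pow_lt; lra).
assert (0 <= f1c ^ 2 + f1s ^ 2) by nra.
nra.
Qed.

Lemma polar_coordinates (a b : R) :
  exists r phi, 0 <= r /\ a = r * cos phi /\ b = r * sin phi.
Proof.
set (r := sqrt (a ^ 2 + b ^ 2)).
assert (r0 : 0 <= r) by apply sqrt_pos.
assert (r2 : r * r = a ^ 2 + b ^ 2) by (apply sqrt_sqrt; nra).
destruct (Req_dec r 0) as [E | N].
{ exists 0, 0; rewrite E in r2; repeat split; nra. }
assert (rp : 0 < r) by lra.
assert (Ha : -1 <= a / r <= 1).
{ split; [apply Rle_div_r | apply Rle_div_l]; nra. }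
assert (Hs : r * sqrt (1 - Rsqr (a / r)) = Rabs b).
{ rewrite <- (sqrt_Rsqr r r0) at 1; rewrite <- sqrt_mult_alt by apply Rle_0_sqr.
  rewrite <- sqrt_Rsqr_abs; f_equal; unfold Rsqr.
  transitivity (r * r - a ^ 2); [field; trivial | rewrite r2; ring]. }
destruct (Rle_or_lt 0 b) as [Hb | Hb].
- exists r, (acos (a / r)); rewrite cos_acos, sin_acos by trivial.
  repeat split; [trivial | now field | rewrite Hs, Rabs_right; lra].
- exists r, (- acos (a / r)); rewrite cos_neg, sin_neg, cos_acos, sin_acos by trivial.
  repeat split; [trivial | now field |].
  rewrite Rabs_left in Hs by trivial; lra.
Qed.

(** The equation is autonomous, so translates of [y] are again solutions. The polar angle of the
    first mode is the translation that cancels its sine part; its modulus [r] is a mean against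
    [cos], hence the amplitude is [2 * r]. *)
Lemma frequency_bound (B C : R) :
  C < 22 / 15 * B ^ 2 ->
  exists s, 0 < s /\
  forall (F y : R -> R) (nu th : R),
  (forall z, ex_derive F z) -> periodic y ->
  (forall t, is_derive y t (- nu * F (y (t - th)))) ->
  Rabs (nu - 1) <= s -> Rabs (th - PI / 2) <= s ->
  (forall t, Rabs (y t) <= s) ->
  (forall t, Rabs (F (y t) - (y t + B * y t ^ 2 + C * y t ^ 3)) <= s * Rabs (y t) ^ 3) ->
  (exists t, y t <> 0) ->
  1 <= nu.
Proof.
intros HBC; destruct (frequency_bound_in_phase B C HBC) as [s [[s0 _] FB]].
exists s; split; [trivial|].
intros F y nu th DF Py Dy Hnu Hth Hy HF [t0 Ht0].
assert (Ey : forall t, ex_derive y t) by (intros; eexists; apply Dy).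
destruct (ex_mean (fun t => y t * cos t)) as [a Ha];
  [intros; auto_derive; repeat split; trivial|].
destruct (ex_mean (fun t => y t * sin t)) as [b Hb];
  [intros; auto_derive; repeat split; trivial|].
destruct (polar_coordinates a b) as [r [phi [r0 [Er Ei]]]].
pose proof (sin2_cos2 phi) as U; unfold Rsqr in U.
assert (cp : forall t, cos (t + 2 * PI - phi) = cos (t - phi)).
{ intros t; replace (t + 2 * PI - phi) with (t - phi + 2 * PI) by ring.
  rewrite cos_plus, cos_2PI, sin_2PI; ring. }
assert (sp : forall t, sin (t + 2 * PI - phi) = sin (t - phi)).
{ intros t; replace (t + 2 * PI - phi) with (t - phi + 2 * PI) by ring.
  rewrite sin_plus, cos_2PI, sin_2PI; ring. }
apply (FB F (fun t => y (t - - phi)) nu th (2 * r)); trivial.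
- now apply periodic_shift.
- intros t; auto_derive; [apply Ey|].
  assert (Dy1 : Derive (fun x => y x) (t - - phi) = - nu * F (y (t - - phi - th)))
    by apply is_derive_unique, Dy.
  replace (t - th - - phi) with (t - - phi - th) by ring.
  unfold Rminus in *; rewrite Dy1; ring.
- exists (t0 - phi); now replace (t0 - phi - - phi) with t0 by ring.
- lra.
- apply is_mean_ext with (fun t => y (t - - phi) * cos (t - - phi - phi)).
  { intros t; do 2 f_equal; ring. }
  apply (is_mean_shift (- phi) (fun t => y t * cos (t - phi))).
  + intros t; now rewrite Py, cp.
  + intros t; auto_derive; repeat split; trivial.
  + replace (2 * r / 2) with (cos phi * a + sin phi * b).
    * eapply is_mean_ext; [|exact (is_mean_plus _ _ _ _ (is_mean_scal _ _ _ Ha) (is_mean_scal _ _ _ Hb))].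
      intros t; simpl; rewrite cos_minus; ring.
    * rewrite Er, Ei; transitivity (r * (sin phi * sin phi + cos phi * cos phi)); [ring|].
      rewrite U; field.
- apply is_mean_ext with (fun t => y (t - - phi) * sin (t - - phi - phi)).
  { intros t; do 2 f_equal; ring. }
  apply (is_mean_shift (- phi) (fun t => y t * sin (t - phi))).
  + intros t; now rewrite Py, sp.
  + intros t; auto_derive; repeat split; trivial.
  + replace 0 with (cos phi * b + - sin phi * a) by (rewrite Er, Ei; ring).
    eapply is_mean_ext; [|exact (is_mean_plus _ _ _ _ (is_mean_scal _ _ _ Hb) (is_mean_scal _ _ _ Ha))].
    intros t; simpl; rewrite sin_minus; ring.
Qed.

(** * Cubic Taylor remainder *)

(** One integration of a Taylor remainder. The mean value theorem gives no factor [1 / (n + 1)] but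
    keeps [s] and [d] unchanged, so the step can be iterated from [f3] up to [f]. *)
Lemma bound_of_derive_bound (h dh : R -> R) (d s : R) (n : nat) :
  (forall z, is_derive h z (dh z)) -> h 0 = 0 -> 0 <= s ->
  (forall z, Rabs z <= d -> Rabs (dh z) <= s * Rabs z ^ n) ->
  forall z, Rabs z <= d -> Rabs (h z) <= s * Rabs z ^ S n.
Proof.
intros Dh h0 s0 Hd z Hz.
destruct (MVT_gen h 0 z dh) as [c [Hc E]].
- intros; apply Dh.
- intros u _; apply continuity_pt_filterlim.
  apply (ex_derive_continuous (K := R_AbsRing) (V := R_NormedModule)); eexists; apply Dh.
- rewrite h0, !Rminus_0_r in E; rewrite E.
  assert (cz : Rabs c <= Rabs z).
  { unfold Rmin, Rmax in Hc; destruct (Rle_dec 0 z); unfold Rabs;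
      destruct (Rcase_abs c), (Rcase_abs z); lra. }
  replace (s * Rabs z ^ S n) with ((s * Rabs z ^ n) * Rabs z) by (simpl; ring).
  apply Rabs_mult_le; [|apply Rle_refl].
  eapply Rle_trans; [apply Hd; lra|].
  apply Rmult_le_compat_l; [trivial|]; apply pow_incr; split; [apply Rabs_pos | trivial].
Qed.

Lemma cubic_taylor (f f1 f2 f3 : R -> R) (s : R) :
  C3_with f f1 f2 f3 -> f 0 = 0 -> f1 0 = 1 -> 0 < s ->
  exists d, 0 < d /\ forall z, Rabs z <= d ->
    Rabs (f z - (z + f2 0 / 2 * z ^ 2 + f3 0 / 6 * z ^ 3)) <= s * Rabs z ^ 3.
Proof.
intros [D0 [D1 [D2 C3]]] f0 f10 s0.
destruct (C3 0 s s0) as [a [a0 Ha]].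
(* The exponent 0 starts the iteration. Halving [a] puts the closed ball inside the open one given
   by continuity, and [z = 0] is separate because the continuity condition excludes the centre. *)
assert (H3 : forall z, Rabs z <= a / 2 -> Rabs (f3 z - f3 0) <= s * Rabs z ^ 0).
{ intros z Hz; rewrite pow_O, Rmult_1_r.
  destruct (Req_dec z 0) as [-> | Nz]; [rewrite Rminus_diag, Rabs_R0; lra|].
  apply Rlt_le, Ha; split; [now split; [|apply not_eq_sym]|].
  unfold dist; simpl; unfold Rdist; rewrite Rminus_0_r; lra. }
assert (E0 : forall z, is_derive f z (f1 z)) by (intros; now apply is_derive_Reals).
assert (E1 : forall z, is_derive f1 z (f2 z)) by (intros; now apply is_derive_Reals).
assert (E2 : forall z, is_derive f2 z (f3 z)) by (intros; now apply is_derive_Reals).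
assert (H2 : forall z, Rabs z <= a / 2 -> Rabs (f2 z - f2 0 - f3 0 * z) <= s * Rabs z ^ 1).
{ apply (bound_of_derive_bound _ (fun z => f3 z - f3 0)); [|ring|lra|trivial].
  intros z; auto_derive; [eexists; apply E2|].
  assert (X : Derive (fun x => f2 x) z = f3 z) by apply is_derive_unique, E2.
  rewrite X; ring. }
assert (H1 : forall z, Rabs z <= a / 2 ->
  Rabs (f1 z - 1 - f2 0 * z - f3 0 / 2 * z ^ 2) <= s * Rabs z ^ 2).
{ apply (bound_of_derive_bound _ (fun z => f2 z - f2 0 - f3 0 * z));
    [|rewrite f10; ring|lra|trivial].
  intros z; auto_derive; [eexists; apply E1|].
  assert (X : Derive (fun x => f1 x) z = f2 z) by apply is_derive_unique, E1.
  rewrite X; simpl; field. }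
exists (a / 2); split; [lra|].
apply (bound_of_derive_bound _ (fun z => f1 z - 1 - f2 0 * z - f3 0 / 2 * z ^ 2));
  [|rewrite f0; ring|lra|trivial].
intros z; auto_derive; [eexists; apply E0|].
assert (X : Derive (fun x => f x) z = f1 z) by apply is_derive_unique, E0.
rewrite X; simpl; field.
Qed.

(** * Application to the Hopf branch *)

Lemma is_period_iter (x : R -> R) (T : R) (k : nat) :
  is_period x T -> forall t, x (t + INR k * T) = x t.
Proof.
intros HT; induction k as [|k IH]; intros t.
- simpl; f_equal; ring.
- rewrite S_INR, <- (IH t), <- (HT (t + INR k * T)); f_equal; ring.
Qed.

Lemma H_le (k : nat) : H k <= 22 / 15.
Proof.
pose proof PI_RGT_0 as Pi0; pose proof (pos_INR k) as k0.
unfold H; apply Rle_div_l; [|lra].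
assert (0 < 4 * INR k + 1) by lra; nra.
Qed.

Theorem theorem2 (f f1 f2 f3 : R -> R) (k : nat) (eta0 : R) (p : R -> R -> R) :
  C3_with f f1 f2 f3 ->
  f 0 = 0 ->
  f1 0 = 1 ->
  f3 0 / 6 < H k * (f2 0 / 2) ^ 2 ->
  supercritical_hopf_branch f k eta0 p ->
  exists eta1, 0 < eta1 /\
    forall eta T, 0 < eta < eta1 -> eta < eta0 ->
      is_min_period (p eta) T ->
      T >= 4 / (4 * INR k + 1 + 2 * eta / PI).
Proof.
intros Hf Hf0 Hf1 HC [_ [Hsol [Hamp Hper]]].
assert (HBC : f3 0 / 6 < 22 / 15 * (f2 0 / 2) ^ 2).
{ eapply Rlt_le_trans; [exact HC|]; apply Rmult_le_compat_r;
    [apply pow2_ge_0 | apply H_le]. }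
destruct (frequency_bound _ _ HBC) as [s [s0 FB]].
destruct (cubic_taylor f f1 f2 f3 s Hf Hf0 Hf1 s0) as [d [d0 Hd]].
destruct (Hamp (Rmin s d)) as [g [g0 Hg]]; [now apply Rmin_pos|].
pose proof PI_RGT_0 as Pi0; pose proof PI2_3_2 as Pi3; pose proof (pos_INR k) as k0.
set (q := 4 * INR k + 1) in *.
assert (q1 : 1 <= q) by (unfold q; lra).
assert (T0pos : 0 < T0 k) by (apply Rdiv_lt_0_compat; fold q; lra).
assert (qT0 : q * T0 k = 4) by (unfold T0; fold q; field; lra).
assert (T04 : T0 k <= 4) by nra.
(* The three entries keep [T] above [T0 k / 2], bound [(T - T0 k) / T0 k] by [s / 2], and bound the
   deviation of the reduced delay from [PI / 2] by [s]. The remaining part of [nu - 1] is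
   [eta * T / (2 * PI)], for which [eta < s / 4] and [T <= 6] suffice. *)
set (e := Rmin (T0 k / 2) (Rmin (s * T0 k / 2) (s * T0 k ^ 2 / (4 * PI)))).
assert (e0 : 0 < e).
{ repeat apply Rmin_pos; try lra; [nra|].
  apply Rdiv_lt_0_compat; [apply Rmult_lt_0_compat; [lra | now apply pow_lt] | lra]. }
assert (e1 : e <= T0 k / 2) by apply Rmin_l.
assert (e2 : e <= s * T0 k / 2) by (eapply Rle_trans; [apply Rmin_r | apply Rmin_l]).
assert (e3 : e * (4 * PI) <= s * T0 k ^ 2).
{ apply Rle_div_r; [lra|]; eapply Rle_trans; [apply Rmin_r | apply Rmin_r]. }
destruct (Hper e e0) as [h [h0 Hh]].
exists (Rmin g (Rmin h (s / 4))); split; [repeat apply Rmin_pos; lra|].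
intros eta T [eta_pos Heta] Heta0 HT.
assert (Hetag : eta < g) by (eapply Rlt_le_trans; [exact Heta | apply Rmin_l]).
assert (Hetah : eta < h).
{ eapply Rlt_le_trans; [exact Heta|]; eapply Rle_trans; [apply Rmin_r | apply Rmin_l]. }
assert (Hetas : eta < s / 4).
{ eapply Rlt_le_trans; [exact Heta|]; eapply Rle_trans; [apply Rmin_r | apply Rmin_r]. }
pose proof (Hh eta T (conj eta_pos Hetah) Heta0 HT) as HTe.
apply Rabs_lt_between in HTe.
destruct HT as [Tpos [PT _]].
destruct (Hsol eta (conj eta_pos Heta0)) as [Sol [[u [v Huv]] _]].
set (x := p eta) in *.
set (mu := mu_k k + eta) in *.
set (c := T / (2 * PI)).
assert (c0 : 0 < c) by (apply Rdiv_lt_0_compat; lra).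
assert (cT : c * (2 * PI) = T) by (unfold c; field; lra).
assert (mupos : 0 < mu) by (unfold mu, mu_k; fold q; nra).
assert (Hx : forall t, Rabs (x t) <= Rmin s d)
  by (intros; apply Rlt_le, Hg; [now split | trivial]).
assert (Bnd : 1 <= mu * c).
{ apply (FB f (fun t => x (c * t)) (mu * c) (/ c - 2 * PI * INR k)).
  - intros z; eexists; apply is_derive_Reals, Hf.
  - intros t; rewrite Rmult_plus_distr_l, cT; apply PT.
  - intros t.
    replace (x (c * (t - (/ c - 2 * PI * INR k)))) with (x (c * t - 1)).
    (* The rescaled delay is [/ c]; dropping [2 * PI * INR k] from it moves the argument of [x] by
       [k] periods [T]. *)
    2: { rewrite <- (is_period_iter x T k PT (c * t - 1)), <- cT; f_equal; field; lra. }
    replace (- (mu * c) * f (x (c * t - 1))) with (c * (- mu * f (x (c * t - 1)))) by ring.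
    apply (is_derive_comp x (fun t => c * t) t); [apply is_derive_Reals, Sol|].
    auto_derive; [trivial | ring].
  - replace (mu * c - 1) with ((T - T0 k) / T0 k + eta * T / (2 * PI)).
    2: { unfold mu, mu_k, c, T0; fold q; field; lra. }
    assert (A1 : Rabs ((T - T0 k) / T0 k) <= s / 2).
    { unfold Rdiv; rewrite Rabs_mult, (Rabs_right (/ T0 k))
        by (apply Rle_ge, Rlt_le, Rinv_0_lt_compat; lra).
      apply Rle_div_l; [lra|]; apply Rabs_le; lra. }
    assert (A2 : 0 <= eta * T / (2 * PI) <= s / 2).
    { split; [apply Rlt_le, Rdiv_lt_0_compat; nra|].
      apply Rle_div_l; [lra|].
      assert (T <= 6) by lra. nra. }
    apply Rabs_le; apply Rabs_le_between in A1; lra.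
  - replace (/ c - 2 * PI * INR k - PI / 2) with ((T0 k - T) * (2 * PI) / (T * T0 k)).
    2: { unfold c, T0; fold q; replace (INR k) with ((q - 1) / 4) by (unfold q; field);
         field; lra. }
    unfold Rdiv; rewrite Rabs_mult, (Rabs_right (/ (T * T0 k)))
      by (apply Rle_ge, Rlt_le, Rinv_0_lt_compat; nra).
    apply Rle_div_l; [nra|].
    rewrite Rabs_mult, (Rabs_right (2 * PI)) by lra.
    assert (Rabs (T0 k - T) <= e) by (apply Rabs_le; lra).
    assert (s * (T0 k / 2 * T0 k) <= s * (T * T0 k)) by (apply Rmult_le_compat_l; nra).
    nra.
  - intros t; eapply Rle_trans; [apply Hx | apply Rmin_l].
  - intros t; apply Hd; eapply Rle_trans; [apply Hx | apply Rmin_r].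
  - destruct (Req_dec (x u) 0) as [Eu | Nu].
    + exists (v / c); replace (c * (v / c)) with v by (field; lra); lra.
    + exists (u / c); replace (c * (u / c)) with u by (field; lra); lra. }
apply Rle_ge.
replace (4 / (q + 2 * eta / PI)) with (2 * PI / mu).
2: { unfold mu, mu_k; fold q; field; split; nra. }
apply Rle_div_l; [trivial|].
rewrite <- cT; nra.
Qed.
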